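(* Let $d=2$ and let $\mu$ be a probability measure on the power set of $\mathcal{E}=\{e_1,e_2,-e_1,-e_2\}$. Assume that at least one of the following two sets of hypotheses holds: (H1) $\mu(\{A: e\in A\})>0$ for each $e\in\mathcal{E}$, and $\mu(\{A: A\cap\{e_2,-e_1\}\neq\emptyset\})=\mu(\{A: A\cap\{-e_2,e_1\}\neq\emptyset\})=1$; (H2) $\mu(\{A: A\cap\{e_2,e_1\}\neq\emptyset\})=\mu(\{A: A\cap\{e_2,-e_1\}\neq\emptyset\})=1$, and $\mu(\{A: e\in A\})>0$ for every $e\in\mathcal{E}$ with $e\neq -e_2$. Then there is $\nu$-almost surely a gigantic $\mathcal{M}$-component if and only if $\nu(\mathcal{B}_o=\mathbb{Z}^2)>0$.
   Context: Let $e_1,e_2$ be the standard basis of $\mathbb{Z}^2$ and $o$ the origin. The environment $\mathcal{G}=(\mathcal{G}_x)_{x\in\mathbb{Z}^2}$ is a family of i.i.d. random subsets of $\mathcal{E}$ with law $\mu$; its law is $\nu=\mu^{\otimes\mathbb{Z}^2}$. Write $x\to y$ if there are $n\ge 0$ and $x=x_0,\dots,x_n=y$ with $x_{i+1}-x_i\in\mathcal{G}_{x_i}$ for $0\le i<n$. Let $\mathcal{B}_y=\{x: x\to y\}$, $\mathcal{C}_x=\{y: x\to y\}$ and $\mathcal{M}_x=\mathcal{B}_x\cap\mathcal{C}_x$. The environment $\mathcal{G}$ has a gigantic $\mathcal{M}$-component if there is an $x$ such that $\mathcal{M}_x$ is infinite and all connected components (with respect to nearest-neighbour adjacency in $\mathbb{Z}^2$)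 of $\mathbb{Z}^2\setminus\mathcal{M}_x$ are finite. *)

(* Defs.v *)
From HB Require Import structures.
From mathcomp Require Import all_boot all_order all_algebra.
From mathcomp Require Import all_classical all_reals all_analysis.

Set Implicit Arguments.
Unset Strict Implicit.
Unset Printing Implicit Defensive.

Import GRing.Theory.

Local Open Scope ring_scope.
Local Open Scope classical_set_scope.

Notation Z2 := (int * int)%type.

Definition e1 : Z2 := (1, 0).
Definition e2 : Z2 := (0, 1).

Definition steps : seq Z2 := [:: e1; e2; - e1; - e2].

Definition stepE : finType := seq_sub steps.

Definition pe1 : stepE := SeqSub (isT : e1 \in steps).
Definition pe2 : stepE := SeqSub (isT : e2 \in steps).
Definition ne1 : stepE := SeqSub (isT : - e1 \in steps).
Definition ne2 : stepE := SeqSub (isT : - e2 \in steps).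

(* {set stepE} carries no measurable structure in the library. *)
HB.instance Definition _ := isPointed.Build {set stepE} finset.set0.
HB.instance Definition _ := @isMeasurable.Build default_measure_display
  {set stepE} discrete_measurable discrete_measurable0
  discrete_measurableC discrete_measurableU.

Definition cylinders : set (set (Z2 -> {set stepE})) :=
  \bigcup_(x in [set: Z2])
    preimage_set_system setT (fun w : Z2 -> {set stepE} => w x) measurable.

Definition environment := g_sigma_algebraType cylinders.

(* [nu] is the infinite product of copies of [mu]: its finite-dimensional
   marginals are the finite products.  They generate the sigma-algebra of
   [environment], so there is at most one such [nu]. *)
Definition is_product_measure (R : realType)
    (mu : probability {set stepE} R) (nu : probability environment R) : Prop :=
  forall (s : seq Z2) (A : Z2 -> set {set stepE}), uniq s ->
    (nu [set w : environment | forall x, x \in s -> A x (w x)]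
     = \prod_(x <- s) mu (A x))%E.

Section Environment.
Variable w : environment.

Definition step : rel Z2 :=
  fun x y => [exists e : stepE, (e \in w x) && (y - x == val e)].

Definition reaches (x y : Z2) : Prop :=
  exists p : seq Z2, path step x p /\ last x p = y.

Definition Bset (y : Z2) : set Z2 := [set x | reaches x y].
Definition Cset (x : Z2) : set Z2 := [set y | reaches x y].
Definition Mset (x : Z2) : set Z2 := Bset x `&` Cset x.

End Environment.

Definition adjacent : rel Z2 := fun x y => y - x \in steps.

(* The connected component of [y] in the subgraph of Z2 induced by [S];
   meaningful for [y] in [S]. *)
Definition component (S : set Z2) (y : Z2) : set Z2 :=
  [set z | exists p : seq Z2,
    [/\ path adjacent y p, last y p = z & forall u, u \in y :: p -> S u]].

Definition has_gigantic_M (w : environment) : Prop :=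
  exists x : Z2, infinite_set (Mset w x) /\
    forall y, (~` Mset w x) y -> finite_set (component (~` Mset w x) y).

Definition hypH1 (R : realType) (mu : probability {set stepE} R) : Prop :=
  (forall e : stepE, (0 < mu [set A : {set stepE} | e \in A])%E) /\
  (mu [set A : {set stepE} | A :&: [set pe2; ne1]%SET != finset.set0] = 1%E /\
   mu [set A : {set stepE} | A :&: [set ne2; pe1]%SET != finset.set0] = 1%E).

Definition hypH2 (R : realType) (mu : probability {set stepE} R) : Prop :=
  (mu [set A : {set stepE} | A :&: [set pe2; pe1]%SET != finset.set0] = 1%E /\
   mu [set A : {set stepE} | A :&: [set pe2; ne1]%SET != finset.set0] = 1%E) /\
  (forall e : stepE, e != ne2 -> (0 < mu [set A : {set stepE} | e \in A])%E).

(* Main.v *)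
Require Import Defs.
From HB Require Import structures.
From mathcomp Require Import all_boot all_order all_algebra.
From mathcomp Require Import zify ring lra.
From mathcomp Require Import all_classical all_reals all_analysis.

(* Call a site a sink when it is reached from every site, i.e. [Bset w x] is the
   whole plane.  Sinks form a forward closed set, which is the [Mset] of each of
   its elements.

   If there is a gigantic component [Mset w x], an infinite path of north and
   west steps from any site leaves the finite components of the complement, so
   it meets [Mset w x]; hence [x] is a sink, and by translation invariance the
   origin is one with positive probability.

   Conversely, let the origin be a sink with positive probability.  By
   ergodicity every lattice ray contains sinks almost surely, and it remains to
   see that the set of sinks encloses each other site [y].  Under (H2), start
   from a sink below [y]: its north-west and north-east paths pass on both sides
   of [y], and their continuations meet above [y].  Under (H1), take one sink on
   each side of [y] on its diagonal.  North-west walks started from them, the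
   upper one preferring west and the lower one preferring north, move along
   common antidiagonals; their distance is a lazy walk with nonpositive drift,
   so they merge.  The same holds for south-east walks, and the four walks
   surround [y]. *)

Set Implicit Arguments.
Unset Strict Implicit.
Unset Printing Implicit Defensive.

Import Order.TTheory GRing.Theory Num.Theory.
Import numFieldNormedType.Exports.

Local Open Scope ring_scope.
Local Open Scope classical_set_scope.

(** * Environments and the product measure *)

Definition cylinder (s : seq Z2) (A : Z2 -> set {set stepE}) :
    set environment :=
  [set w : environment | forall x, x \in s -> A x (w x)].

Definition cylinder_sets : set (set environment) :=
  [set C | exists s A, uniq s /\ C = cylinder s A].

Lemma measurable_coord (x : Z2) (B : set {set stepE}) :
  measurable [set w : environment | B (w x)].
Proof.
apply: sub_sigma_algebra; exists x => //; exists B => //.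
by rewrite setTI.
Qed.

Lemma measurable_fun_environment d (T : measurableType d)
    (f : T -> environment) :
  (forall x (B : set {set stepE}), measurable [set t | B (f t x)]) ->
  measurable_fun setT f.
Proof.
move=> mf; apply: (@measurability _ _ _ _ setT f cylinders) => //.
move=> _ [_ [x _ [B _ <-]] <-]; rewrite !setTI.
exact: mf.
Qed.

Lemma measurable_cylinder s A : measurable (cylinder s A).
Proof.
rewrite (_ : cylinder s A =
    \big[setI/setT]_(x <- s) [set w : environment | A x (w x)]).
  by apply: bigsetI_measurable => x _; exact: measurable_coord.
elim: s => [|y s IH].
  by rewrite big_nil; apply/seteqP; split.
rewrite big_cons -IH; apply/seteqP; split => w /=.
  by move=> h; split=> [|x xs]; apply: h; rewrite in_cons ?eqxx// xs orbT.
by move=> [hy h] x; rewrite in_cons => /orP[/eqP->//|/h].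
Qed.

Lemma cylinder_setsI : setI_closed cylinder_sets.
Proof.
move=> _ _ [s1 [A1 [_ ->]]] [s2 [A2 [_ ->]]].
exists (undup (s1 ++ s2)),
  (fun x => [set a | (x \in s1 -> A1 x a) /\ (x \in s2 -> A2 x a)]).
split; first exact: undup_uniq.
apply/seteqP; split => w /=.
  by move=> [h1 h2] x _; split=> ?; [exact: h1|exact: h2].
move=> h; split=> x xs; have := h x; rewrite mem_undup mem_cat xs ?orbT.
  by case/(_ isT) => /(_ isT).
by case/(_ isT) => _ /(_ isT).
Qed.

(** The one-site generators are not closed under intersection; finite cylinders generate the same
    sigma-algebra and form a pi-system. *)
Lemma measurable_cylinder_sets :
  @measurable _ environment = <<s cylinder_sets >>.
Proof.
apply/seteqP; split.
  apply: sub_sigma_algebra2 => _ [x _ [B _ <-]].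
  exists [:: x], (fun=> B); split=> //; rewrite setTI.
  apply/seteqP; split=> w /=.
    by move=> Bw y; rewrite inE => /eqP ->.
  by apply; rewrite inE.
apply: smallest_sub; first exact: sigma_algebra_measurable.
by move=> _ [s [A [_ ->]]]; exact: measurable_cylinder.
Qed.

Lemma cylinder_nil (A : Z2 -> set {set stepE}) : cylinder [::] A = setT.
Proof. by apply/seteqP; split. Qed.

(** By the pi-lambda theorem the law of [f] is fixed by its values on cylinders. The source space is
    arbitrary, so that both translations and resampling are covered. *)
Lemma preimage_measure_unique d (T : measurableType d) (R : realType)
    (m : {measure set T -> \bar R}) (nu : probability environment R)
    (f : T -> environment) : measurable_fun setT f ->
  (forall s A, uniq s -> m (f @^-1` cylinder s A) = nu (cylinder s A)) ->
  forall E, measurable E -> m (f @^-1` E) = nu E.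
Proof.
move=> mf mnu E mE.
have cylT : cylinder_sets setT.
  by exists [::], (fun=> setT); rewrite cylinder_nil.
have m_cyl : cylinder_sets `<=` measurable.
  by move=> _ [s [A [_ ->]]]; exact: measurable_cylinder.
have @m' : {measure set environment -> \bar R}.
  by refine (Measure.clone _ _ _ (pushforward m f) _); exact: mf.
apply: (@g_sigma_algebra_measure_unique _ _ _ cylinder_sets m_cyl
  (fun=> setT) (fun=> cylT) _ m' nu) => //.
- by rewrite bigcup_const.
- exact: cylinder_setsI.
- by move=> _ [s [A [us ->]]]; exact: mnu.
- move=> _; rewrite /m' /= -[setT](cylinder_nil (fun=> setT)).
  by rewrite /pushforward mnu// cylinder_nil probability_setT ltry.
- by rewrite -measurable_cylinder_sets.
Qed.

Definition update (w : environment) (x : Z2) (a : {set stepE}) : environment :=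
  fun y => if y == x then a else w y.

Definition translate (v : Z2) (w : environment) : environment :=
  fun x => w (x + v).

Lemma measurable_translate v : measurable_fun setT (translate v).
Proof.
by apply: measurable_fun_environment => x B; exact: measurable_coord.
Qed.

Lemma measurable_update x :
  measurable_fun setT
    (fun p : {set stepE} * environment => update p.2 x p.1 : environment).
Proof.
apply: measurable_fun_environment => y B; rewrite /update.
case: (y == x) => /=.
  rewrite (_ : [set _ | _] = B `*` setT); first exact: measurableX.
  by apply/seteqP; split => -[a w] //= [].
rewrite (_ : [set _ | _] = setT `*` [set w : environment | B (w y)]).
  by apply: measurableX => //; exact: measurable_coord.
by apply/seteqP; split => -[a w] //= [].
Qed.

Lemma measurable_update_section w_ x (E : set environment) :
  measurable E ->
  measurable [set w : environment | E (update w x w_)].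
Proof.
move=> mE.
have := measurable_xsection w_ ((measurable_update x) measurableT _ mE).
rewrite setTI; congr measurable; apply/seteqP.
by split=> w; rewrite /xsection /= inE.
Qed.

Section Product.
Context (R : realType) (mu : probability {set stepE} R)
  (nu : probability environment R).
Hypothesis hnu : is_product_measure mu nu.

Lemma cylinderE s A : uniq s -> nu (cylinder s A) = (\prod_(x <- s) mu (A x))%E.
Proof. exact: hnu. Qed.

Lemma measure_translate v E : measurable E -> nu (translate v @^-1` E) = nu E.
Proof.
apply: preimage_measure_unique; first exact: measurable_translate.
move=> s A us; rewrite cylinderE//.
rewrite (_ : _ @^-1` _ = cylinder [seq x + v | x <- s] (fun x => A (x - v))).
  apply: etrans (cylinderE _ _) _.
    by rewrite map_inj_uniq//; exact: addIr.
  by rewrite big_map; apply: eq_bigr => x _; rewrite addrK.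
apply/seteqP; split => w /=.
  by move=> h _ /mapP[x xs ->]; rewrite addrK; exact: h.
move=> h x xs; have := h (x + v); rewrite addrK; apply.
exact: map_f.
Qed.

(** The map [update] sends the product of [mu] and [nu] to [nu], since it does so on cylinders,
    where the factor at [x] splits off. This is Fubini with one coordinate singled out. *)
Lemma resample x E : measurable E ->
  nu E = (\int[mu]_a nu [set w : environment | E (update w x a)])%E.
Proof.
move=> mE.
rewrite -(preimage_measure_unique (m := (mu \x nu)%E) (measurable_update x)) //.
  rewrite /product_measure1 /=; apply: eq_integral => a _ /=; congr (nu _).
  by apply/seteqP; split=> w; rewrite /xsection /= inE.
move=> s A us.
rewrite cylinderE//.
pose B := if x \in s then A x else setT.
rewrite (_ : _ @^-1` _ = B `*` cylinder (rem x s) A).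
  apply: etrans (product_measure1E _ _ _ _) _ => //.
    exact: measurable_cylinder.
  apply: etrans (congr1 (mule _) (cylinderE A (rem_uniq x us))) _.
  rewrite /B.
  case: ifPn => xs; first by rewrite (perm_big _ (perm_to_rem xs)) big_cons.
  apply: etrans (congr1 (mule^~ _) (probability_setT mu)) _.
  by rewrite mul1e rem_id.
apply/seteqP; split => -[a w] /=; rewrite /update /B.
  move=> h; split.
    by case: ifPn => // xs; have := h x xs; rewrite eqxx.
  move=> y; rewrite mem_rem_uniq// inE => /andP[yx ys].
  by have := h y ys; rewrite (negbTE yx).
move=> [h1 h2] y ys; case: eqVneq => yx; first by move: h1; rewrite -yx ys.
by apply: h2; rewrite mem_rem_uniq// inE yx.
Qed.

End Product.

(** * Real-valued probabilities *)

Section RealProbability.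
Context d (T : measurableType d) (R : realType) (P : probability T R).

Definition pr (E : set T) : R := fine (P E).

Lemma prE E : measurable E -> P E = (pr E)%:E.
Proof. by move=> mE; rewrite /pr fineK// fin_num_measure. Qed.

Lemma pr_ge0 E : measurable E -> 0 <= pr E.
Proof. by move=> mE; rewrite /pr fine_ge0. Qed.

Lemma pr_setT : pr setT = 1.
Proof. by rewrite /pr probability_setT. Qed.

Lemma pr_set0 : pr set0 = 0.
Proof. by rewrite /pr measure0. Qed.

Lemma pr_le A B : measurable A -> measurable B -> A `<=` B -> pr A <= pr B.
Proof.
move=> mA mB AB; rewrite -lee_fin -!prE//.
by apply: le_measure => //; rewrite inE.
Qed.

Lemma pr_le1 A : measurable A -> pr A <= 1.
Proof. by move=> mA; rewrite -pr_setT; apply: pr_le. Qed.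

Lemma pr_setU A B : measurable A -> measurable B -> A `&` B = set0 ->
  pr (A `|` B) = pr A + pr B.
Proof.
move=> mA mB AB; apply: EFin_inj; rewrite EFinD -!prE//; last exact: measurableU.
by rewrite measureU.
Qed.

Lemma pr_setU_le A B : measurable A -> measurable B ->
  pr (A `|` B) <= pr A + pr B.
Proof.
move=> mA mB; rewrite -lee_fin EFinD -!prE//; last exact: measurableU.
exact: measureU2.
Qed.

Lemma pr_setC A : measurable A -> pr (~` A) = 1 - pr A.
Proof.
move=> mA; apply/(addrI (pr A)); rewrite -pr_setU//; last 2 first.
- exact: measurableC.
- by rewrite setICr.
by rewrite setUCr pr_setT addrC subrK.
Qed.

Lemma pr_split A B : measurable A -> measurable B ->
  pr A = pr (A `&` B) + pr (A `\` B).
Proof.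
move=> mA mB; rewrite -pr_setU; first by rewrite setDE -setIUr setUCr setIT.
- exact: measurableI.
- exact: measurableD.
- by rewrite setDE setIACA setICr setI0.
Qed.

Lemma measurable_setY (A B : set T) : measurable A -> measurable B ->
  measurable (A `+` B).
Proof. by move=> mA mB; apply: measurableU; exact: measurableD. Qed.

Lemma pr_sub_setY A B : measurable A -> measurable B ->
  `|pr A - pr B| <= pr (A `+` B).
Proof.
move=> mA mB.
have mY := measurable_setY mA mB.
rewrite ler_norml; apply/andP; split.
  rewrite lerNl opprB lerBlDl.
  apply: le_trans (pr_setU_le mA mY); apply: pr_le => //.
    exact: measurableU.
  move=> x Bx; rewrite /setY /=.
  by have [Ax|nAx] := pselect (A x); [left|right; right].
rewrite lerBlDl.
apply: le_trans (pr_setU_le mB mY); apply: pr_le => //.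
  exact: measurableU.
move=> x Ax; rewrite /setY /=.
by have [Bx|nBx] := pselect (B x); [left|right; left].
Qed.

Lemma pr_le_cover A B C : measurable A -> measurable B -> measurable C ->
  A `<=` B `|` C -> pr A <= pr B + pr C.
Proof.
move=> mA mB mC ABC; apply: le_trans (pr_setU_le mB mC); apply: pr_le => //.
exact: measurableU.
Qed.

(** The remainders decrease to the empty set, so continuity from above applies. *)
Lemma pr_bigcup_approx (F : (set T)^nat) : (forall n, measurable (F n)) ->
  forall e, 0 < e -> exists n,
    pr ((\bigcup_k F k) `\` \big[setU/set0]_(k < n) F k) <= e.
Proof.
move=> mF e e0.
have mU : measurable (\bigcup_k F k) by exact: bigcupT_measurable.
pose G n := (\bigcup_k F k) `\` \big[setU/set0]_(k < n) F k.
have mG n : measurable (G n).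
  by apply: measurableD => //; exact: bigsetU_measurable.
have G0 : \bigcap_n G n = set0.
  apply/seteqP; split=> // x Gx.
  have [[k _ Fk] _] := Gx 0%N I.
  have [_] := Gx k.+1 I; apply; rewrite -bigcup_mkord.
  by exists k => /=.
have : (P \o G) @ \oo --> P (\bigcap_n G n).
  apply: nonincreasing_cvg_mu => //.
  - apply: le_lt_trans (ltry 1); exact: probability_le1.
  - exact: bigcapT_measurable.
  - move=> n m nm; apply/subsetPset; apply: setDS.
    rewrite -!bigcup_mkord => x [k /= kn Fk]; exists k => //=.
    exact: leq_trans kn nm.
rewrite G0 measure0 => /fine_cvgP[_] /cvgrPdist_le /(_ e e0) [n _ /(_ n)] /=.
rewrite leqnn sub0r normrN => /(_ isT) h; exists n.
exact: le_trans (ler_norm _) h.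
Qed.

End RealProbability.

(** * Independence and approximation *)

Definition depends_on (D : set Z2) (E : set environment) :=
  forall w w', {in D, w =1 w'} -> E w -> E w'.

Section Product.
Context (R : realType) (mu : probability {set stepE} R)
  (nu : probability environment R).
Hypothesis hnu : is_product_measure mu nu.

(** Induction on [s]: resampling the site [x] leaves [G] unchanged and turns [F] into sections that
    depend on the remaining sites only, so the factor of [G] comes out of the integral. *)
Lemma independent (s : seq Z2) (F G : set environment) :
  measurable F -> measurable G ->
  depends_on [set` s] F -> depends_on (~` [set` s]) G ->
  pr nu (F `&` G) = pr nu F * pr nu G.
Proof.
elim: s F => [|x s IH] F mF mG dF dG.
  (* With no site left, [F] is everything or empty. *)
  have [[w Fw]|F0] := pselect (exists w, F w).
    have -> : F = setT.
      apply/seteqP; split=> // w' _; apply: dF Fw => x; rewrite inE //.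
    by rewrite setTI pr_setT mul1r.
  have -> : F = set0 by apply/seteqP; split=> // w Fw; case: F0; exists w.
  by rewrite set0I pr_set0 mul0r.
have mFa a : measurable [set w : environment | F (update w x a)].
  exact: measurable_update_section.
have mFG := measurableI _ _ mF mG.
apply: EFin_inj; rewrite EFinM -!prE//.
rewrite (resample hnu x mFG) (resample hnu x mF).
rewrite -ge0_integralZr//.
apply: eq_integral => a _.
have -> : [set w | (F `&` G) (update w x a)] =
    [set w | F (update w x a)] `&` G.
  suff GE w : G w <-> G (update w x a).
    apply/seteqP; split=> w [? Gw]; split=> //; [exact: (GE w).2 | exact: (GE w).1].
  by split; apply: dG => y; rewrite inE /update /= inE; case: eqP.
apply: etrans (prE nu (measurableI _ _ (mFa a) mG)) _.
rewrite IH//; first by rewrite EFinM -!prE.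
- move=> w w' ww'; apply: dF => y; rewrite inE /= inE /update.
  by case: eqP => //= _ ys; apply: ww'; rewrite inE.
- move=> w w' ww'; apply: dG => y; rewrite inE /= => ys; apply: ww'.
  by rewrite inE /= => ys'; apply: ys; rewrite inE ys' orbT.
Qed.

Definition approximable (E : set environment) := forall e : R, 0 < e ->
  exists (s : seq Z2) F, [/\ measurable F,
    depends_on [set` s] F & pr nu (E `+` F) <= e].

Lemma approximableC E : approximable E -> approximable (~` E).
Proof.
move=> aE e /aE [s [F [mF dF EF]]]; exists s, (~` F); split.
- exact: measurableC.
- move=> w w' ww' nFw Fw'; apply: nFw; apply: dF Fw' => x xs.
  by rewrite ww'.
- by apply: le_trans EF; rewrite /setY !setDE !setCK setUC setIC (setIC F).
Qed.

Lemma approximableU E E' : measurable E -> measurable E' ->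
  approximable E -> approximable E' -> approximable (E `|` E').
Proof.
move=> mE mE' aE aE' e e0.
have e20 : 0 < e / 2 by rewrite divr_gt0.
have [s [F [mF dF EF]]] := aE _ e20.
have [s' [F' [mF' dF' EF']]] := aE' _ e20.
exists (s ++ s'), (F `|` F'); split; first exact: measurableU.
- move=> w w' ww' [Fw|Fw]; [left; apply: dF Fw|right; apply: dF' Fw];
    by move=> x; rewrite inE /= => xs; apply: ww'; rewrite inE /= mem_cat xs ?orbT.
- rewrite (splitr e); apply: le_trans (lerD EF EF').
  apply: pr_le_cover; [|exact: measurable_setY|exact: measurable_setY|].
    by apply: measurable_setY; exact: measurableU.
  by move=> w; rewrite /setY /setU /setD /=; tauto.
Qed.

Lemma approximable_close E : measurable E ->
  (forall e, 0 < e -> exists F, [/\ measurable F, approximable F &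
     pr nu (E `+` F) <= e]) -> approximable E.
Proof.
move=> mE aE e e0.
have e20 : 0 < e / 2 by rewrite divr_gt0.
have [F [mF aF EF]] := aE _ e20.
have [s [G [mG dG FG]]] := aF _ e20.
exists s, G; split=> //.
rewrite (splitr e); apply: le_trans (lerD EF FG).
apply: pr_le_cover; try exact: measurable_setY.
by move=> w; rewrite /setY /setU /setD /=; have := pselect (F w); tauto.
Qed.

(** Events determined by finitely many sites approximate themselves. Approximability passes to
    complements and, by truncation to finite unions, to countable unions, so Dynkin induction
    applies. *)
Lemma measurable_approximable E : measurable E -> approximable E.
Proof.
have approx_det (s : seq Z2) F : measurable F -> depends_on [set` s] F ->
    approximable F.
  move=> mF dF e e0; exists s, F; split=> //.
  by rewrite setYK pr_set0 ltW.
rewrite measurable_cylinder_sets.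
apply: (dynkin_induction measurable_cylinder_sets).
- exact: cylinder_setsI.
- by apply: (approx_det [::]).
- move=> _ [s [A [_ ->]]]; apply: (approx_det s).
    exact: measurable_cylinder.
  by move=> w w' ww' h x xs; rewrite -ww' ?inE//; exact: h.
- by move=> S _; exact: approximableC.
- move=> F mF _ aF.
  apply: approximable_close => //; [exact: bigcupT_measurable|].
  move=> e /(pr_bigcup_approx nu mF) [n hn].
  exists (\big[setU/set0]_(k < n) F k); split.
  + exact: bigsetU_measurable.
  + elim: n {hn} => [|n IH].
      by rewrite big_ord0; apply: (approx_det [::]).
    rewrite big_ord_recr; apply: approximableU => //.
    exact: bigsetU_measurable.
  + apply: le_trans hn; rewrite /setY.
    rewrite [X in _ `|` X](_ : _ = set0) ?setU0//.
    apply/seteqP; split=> // w []; rewrite -bigcup_mkord => -[k _ Fk].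
    by case; exists k.
Qed.

End Product.

(** * Translation invariance and recurrence *)

Lemma translateD u v w : translate u (translate v w) = translate (u + v) w.
Proof. by apply/funext => x; rewrite /translate addrA. Qed.

Lemma translate0 w : translate 0 w = w.
Proof. by apply/funext => x; rewrite /translate addr0. Qed.

Lemma measurable_translate_preimage v E :
  measurable E -> measurable (translate v @^-1` E).
Proof.
by move=> mE; rewrite -[X in measurable X]setTI; exact: measurable_translate.
Qed.

Lemma translate_disjoint (v : Z2) (s : seq Z2) : v != 0 ->
  exists n, forall x, x \in s -> x + v *+ n \notin s.
Proof.
move=> v0.
(* [M] bounds the l1 norm on [s]; a nonzero coordinate of [v] times [2 * M + 1] exceeds the distance
   between any two points of [s]. *)
pose M := \max_(x <- s) (`|x.1| + `|x.2|)%N.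
exists (2 * M + 1)%N => x xs; apply/negP => ys.
have xM : (`|x.1| + `|x.2| <= M)%N.
  exact: (@leq_bigmax_seq _ s xpredT (fun x : Z2 => `|x.1| + `|x.2|)%N).
have := @leq_bigmax_seq _ s xpredT (fun x : Z2 => `|x.1| + `|x.2|)%N _ ys isT.
rewrite -/M; case: x v v0 xs ys xM => [a b] [c d] v0 _ _ /= xM.
have -> : ((c, d) : Z2) *+ (2 * M + 1) = (c *+ (2 * M + 1), d *+ (2 * M + 1)).
  elim: (_ + _)%N => // n; rewrite !mulrSr => -> //.
rewrite /= => yM.
suff /andP[/eqP c0 /eqP d0] : (c == 0) && (d == 0) by rewrite c0 d0 in v0.
apply/andP; split; apply: contraT => nz; exfalso.
  have : (`|c *+ (2 * M + 1)| >= 2 * M + 1)%N.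
    by rewrite -mulr_natr abszM natz absz_nat leq_pmull// absz_gt0.
  lia.
have : (`|d *+ (2 * M + 1)| >= 2 * M + 1)%N.
  by rewrite -mulr_natr abszM natz absz_nat leq_pmull// absz_gt0.
lia.
Qed.

Lemma ae_forall_countable d (T : measurableType d) (R : realType)
    (m : {measure set T -> \bar R}) (I : countType) (P : I -> T -> Prop) :
  (forall i, {ae m, forall x, P i x}) -> {ae m, forall x i, P i x}.
Proof.
move=> aeP.
have : {ae m, forall x (n : nat), if unpickle n is Some i then P i x else True}.
  apply: ae_foralln => n; case: unpickle => [i|]; first exact: aeP.
  exact: aeW.
by apply: filterS => x h i; have := h (pickle i); rewrite pickleK.
Qed.

Section Product.
Context (R : realType) (mu : probability {set stepE} R)
  (nu : probability environment R).
Hypothesis hnu : is_product_measure mu nu.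

Lemma pr_translate v E : measurable E -> pr nu (translate v @^-1` E) = pr nu E.
Proof. by move=> mE; rewrite /pr (measure_translate hnu). Qed.

(** Approximate [B] by an event [F] on finitely many sites and shift by a multiple [u] of [v] that
    makes [F] and its translate independent. The translate of [B] lies in [B] and has the same
    probability, so [pr nu B] is nearly the square of [pr nu F]. *)
Lemma zero_one (v : Z2) B : v != 0 -> measurable B ->
  translate v @^-1` B `<=` B -> pr nu B = pr nu B * pr nu B.
Proof.
move=> v0 mB vB.
have vnB n : translate (v *+ n) @^-1` B `<=` B.
  elim: n => [|n IH] w /=; first by rewrite mulr0n translate0.
  by rewrite mulrS -translateD => /vB /IH.
apply/eqP; rewrite -subr_eq0 -normr_le0; apply/ler_addgt0Pr => e e0; rewrite add0r.
(* Two quarters pay for replacing [B] by [F] in the intersection, two for replacing the square of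
   [pr nu F] by that of [pr nu B]. *)
have e40 : 0 < e / 4 by rewrite divr_gt0.
have [s [F [mF dF BF]]] := measurable_approximable nu mB e40.
have [n sn] := translate_disjoint s v0.
set u := v *+ n.
have mBu := measurable_translate_preimage u mB.
have mFu := measurable_translate_preimage u mF.
have ind : pr nu (F `&` translate u @^-1` F) = pr nu F * pr nu F.
  rewrite (independent hnu (s := s)) ?pr_translate//.
  move=> w w' ww'; apply: dF => x; rewrite inE /translate => /= xs.
  by apply: ww'; rewrite inE /=; apply/negP; exact: sn.
have BB : pr nu (B `&` translate u @^-1` B) = pr nu B.
  by rewrite setIC setIidl ?pr_translate//; exact: vnB.
have mY := measurable_setY mB mF.
have mYu := measurable_setY mBu mFu.
have close : `|pr nu (B `&` translate u @^-1` B) -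
      pr nu (F `&` translate u @^-1` F)| <= e / 4 + e / 4.
  apply: le_trans (pr_sub_setY _ _ _) _; try exact: measurableI.
  have BFu : pr nu (translate u @^-1` B `+` translate u @^-1` F) <= e / 4.
    by have := BF; rewrite -(pr_translate u mY).
  apply: le_trans (lerD BF BFu).
  apply: pr_le_cover => //; first by apply: measurable_setY; exact: measurableI.
  move=> w; rewrite /setY /setU /setI /setD /=.
  by have := pselect (F w); have := pselect (B w); tauto.
have closeF := le_trans (pr_sub_setY _ mB mF) BF.
rewrite BB ind in close.
have F1 := pr_le1 nu mF; have B1 := pr_le1 nu mB.
have F0 := pr_ge0 nu mF; have B0 := pr_ge0 nu mB.
move: close closeF; rewrite !ler_norml => /andP[c1 c2] /andP[c3 c4].
by apply/andP; split; nra.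
Qed.

(** The event [B] that some positive multiple of [v] translates into [A] can only shrink under the
    shift by [v]. It is at least as likely as [A], so the zero-one law gives it probability one;
    countably many starting points [y] follow. *)
Lemma recurrence (v : Z2) A : v != 0 -> measurable A -> 0 < pr nu A ->
  {ae nu, forall w y, exists m : nat, A (translate (y + v *+ m.+1) w)}.
Proof.
move=> v0 mA A0; apply: ae_forall_countable => y.
pose B := \bigcup_(m : nat) (translate (v *+ m.+1) @^-1` A).
have mB : measurable B.
  by apply: bigcupT_measurable => m; exact: measurable_translate_preimage.
have AB : pr nu A <= pr nu B.
  rewrite -(pr_translate (v *+ 1) mA); apply: pr_le => //.
    exact: measurable_translate_preimage.
  by move=> w Aw; exists 0%N.
have B1 : pr nu B = 1.
  have BB : pr nu B = pr nu B * pr nu B.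
    apply: (zero_one v0) => // w [m _ /=]; rewrite translateD -mulrSr => Am.
    by exists m.+1.
  have : pr nu B != 0 by rewrite gt_eqF// (lt_le_trans A0).
  by move=> B0; apply: (mulfI B0); rewrite mulr1 -BB.
have mBy := measurable_translate_preimage y mB.
exists (~` (translate y @^-1` B)); split; first exact: measurableC.
  apply: etrans (prE nu (measurableC mBy)) _.
  by rewrite pr_setC// pr_translate// B1 subrr.
apply: subsetC => w [m _ /=]; rewrite translateD addrC => h; by exists m.
Qed.

End Product.

(** * Sites reached from everywhere *)

Lemma stepE_cases (e : stepE) : [\/ e = pe1, e = pe2, e = ne1 | e = ne2].
Proof.
case: e => e ein; have := ein; rewrite !inE.
by case/or4P => /eqP he; [constructor 1|constructor 2|constructor 3|constructor 4];
  apply: val_inj.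
Qed.

Lemma adjacentP u u' : Defs.adjacent u u' -> exists e : stepE, u' = u + val e.
Proof.
by move=> h; exists (SeqSub h); rewrite /= addrC subrK.
Qed.

Lemma Z2_eq (u v : Z2) : u.1 = v.1 -> u.2 = v.2 -> u = v.
Proof. by case: u v => [a b] [c d] /= -> ->. Qed.

Lemma fst_add (u v : Z2) : (u + v).1 = u.1 + v.1. Proof. by []. Qed.
Lemma snd_add (u v : Z2) : (u + v).2 = u.2 + v.2. Proof. by []. Qed.
Lemma fst_opp (u : Z2) : (- u).1 = - u.1. Proof. by []. Qed.
Lemma snd_opp (u : Z2) : (- u).2 = - u.2. Proof. by []. Qed.

Lemma fst_muln (u : Z2) n : (u *+ n).1 = u.1 *+ n.
Proof. by elim: n => // n IH; rewrite !mulrS fst_add IH. Qed.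

Lemma snd_muln (u : Z2) n : (u *+ n).2 = u.2 *+ n.
Proof. by elim: n => // n IH; rewrite !mulrS snd_add IH. Qed.

Definition Z2E := (fst_add, snd_add, fst_opp, snd_opp, fst_muln, snd_muln).

Section Reaches.
Implicit Type w : environment.

Lemma stepP w x y : reflect (exists2 e : stepE, e \in w x & y = x + val e)
  (step w x y).
Proof.
apply: (iffP existsP) => [[e /andP[ew /eqP xy]]|[e ew ->]]; exists e => //.
  by rewrite -xy addrC subrK.
by rewrite ew addrAC subrr add0r /=.
Qed.

Lemma reaches_refl w x : reaches w x x.
Proof. by exists [::]. Qed.

Lemma reaches_trans w x y z : reaches w x y -> reaches w y z -> reaches w x z.
Proof.
move=> [p [xp <-]] [q [yq <-]]; exists (p ++ q).
by rewrite cat_path xp yq last_cat.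
Qed.

Lemma reaches_step w x e : e \in w x -> reaches w x (x + val e).
Proof.
move=> ew; exists [:: x + val e]; split=> //=; rewrite andbT.
by apply/stepP; exists e.
Qed.

Definition sinks w : set Z2 := [set x | Bset w x = setT].

Lemma sinksP w x : sinks w x <-> forall y, reaches w y x.
Proof.
split=> [h y|h]; first by have : setT y by []; rewrite -h.
by apply/seteqP; split=> // y _; exact: h.
Qed.

Lemma sinks_reaches w x y : sinks w x -> reaches w x y -> sinks w y.
Proof.
by move=> /sinksP sx xy; apply/sinksP => z; exact: reaches_trans xy.
Qed.

Lemma sinks_step w x e : sinks w x -> e \in w x -> sinks w (x + val e).
Proof. by move=> sx /reaches_step; exact: sinks_reaches. Qed.

Lemma Mset_sink w x : sinks w x -> Mset w x = sinks w.
Proof.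
move=> sx; apply/seteqP; split=> y; first by move=> [_]; exact: sinks_reaches.
by move=> sy; split; [exact: (sinksP _ _).1|exact: (sinksP _ _).1].
Qed.

Lemma step_translate v w x y :
  step (translate v w) x y = step w (x + v) (y + v).
Proof.
rewrite /step /translate; apply: eq_existsb => e.
by rewrite opprD addrACA subrr addr0.
Qed.

Lemma reaches_translate v w x y :
  reaches (translate v w) x y <-> reaches w (x + v) (y + v).
Proof.
split=> [[p [xp <-]]|[p [xp py]]].
  exists [seq u + v | u <- p]; split; last exact: (last_map (fun u => u + v)).
  apply: (homo_path (f := fun u => u + v)) xp => a b.
  by rewrite step_translate.
exists [seq u - v | u <- p]; split.
  rewrite -[x in path _ x _](addrK v).
  apply: (homo_path (f := fun u => u - v)) xp => a b.
  by rewrite step_translate !subrK.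
by rewrite -[x in last x](addrK v) (last_map (fun u => u - v) p (x + v)) py addrK.
Qed.

Lemma sinks_translate v w x : sinks (translate v w) x <-> sinks w (x + v).
Proof.
split=> /sinksP h; apply/sinksP => y.
  by have /reaches_translate := h (y - v); rewrite subrK.
exact/reaches_translate.
Qed.

(** There are countably many lists of sites, and whether a given list is a path depends on finitely
    many coordinates. *)
Lemma measurable_reaches x y : measurable [set w : environment | reaches w x y].
Proof.
have mpath (p : seq Z2) z : measurable [set w : environment | path (step w) z p].
  elim: p z => [|u p IH] z /=.
    by rewrite (_ : [set _ | _] = setT)//; apply/seteqP; split.
  rewrite (_ : [set _ | _] =
    [set w : environment | step w z u] `&`
    [set w : environment | path (step w) u p]).
    apply: measurableI; last exact: IH.
    have := measurable_coord z
      [set A : {set stepE} | [exists e : stepE, (e \in A) && (u - z == val e)]].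
    by congr measurable.
  by apply/seteqP; split=> w /=; [move=> /andP[]|move=> [-> ->]].
rewrite (_ : [set _ | _] = \bigcup_(p : seq Z2)
    [set w : environment | path (step w) x p /\ last x p = y]).
  apply: countable_bigcupT_measurable => // p.
  have [py|py] := pselect (last x p = y).
    rewrite (_ : [set _ | _] = [set w : environment | path (step w) x p])//.
    by apply/seteqP; split=> w /=; [move=> []|].
  rewrite (_ : [set _ | _] = set0)//.
  by apply/seteqP; split=> w //= [].
by apply/seteqP; split=> w /=; [move=> [p h]; exists p|move=> [p _ h]; exists p].
Qed.

Lemma measurable_sinks x : measurable [set w : environment | sinks w x].
Proof.
rewrite -[X in measurable X]setCK; apply: measurableC.
rewrite (_ : ~` _ = \bigcup_(y : Z2) ~` [set w : environment | reaches w y x]).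
  apply: countable_bigcupT_measurable => // y; apply: measurableC.
  exact: measurable_reaches.
apply/seteqP; split=> w /=.
  move=> nsx; apply: contrapT => h; apply: nsx; apply/sinksP => y.
  by apply: contrapT => nyx; apply: h; exists y.
by move=> [y _ nyx] /sinksP h; exact/nyx/h.
Qed.

End Reaches.

(** A path in the complement of [S] that starts in the trap [A] never leaves it. Finiteness of
    components is later obtained by exhibiting such traps. *)
Lemma component_finite (S A : set Z2) y : finite_set A -> A y ->
  (forall u e, A u -> ~ S (u + val (e : stepE)) -> A (u + val e)) ->
  finite_set (component (~` S) y).
Proof.
move=> fA Ay cA; apply: sub_finite_set fA => z [p [yp <- nS]].
elim: p y Ay yp nS => //= u p IH y Ay /andP[/adjacentP[e ue] up] nS.
apply: IH => //; last by move=> v vup; apply: nS; rewrite inE vup orbT.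
by rewrite ue; apply: cA => //; rewrite -ue; apply: nS; rewrite !inE eqxx orbT.
Qed.

(** * North-west paths and the link between sinks and gigantic components *)

Section NorthWest.
Variable w : environment.
Hypothesis nw : forall x, pe2 \in w x \/ ne1 \in w x.

Definition nw_step (x : Z2) : Z2 := if pe2 \in w x then x + e2 else x - e1.

Lemma reaches_nw x : reaches w x (nw_step x).
Proof.
rewrite /nw_step; case: ifPn => [|nN]; first exact: (@reaches_step _ _ pe2).
case: (nw x) => [N|]; first by rewrite N in nN.
exact: (@reaches_step _ _ ne1).
Qed.

Lemma reaches_iter_nw n x : reaches w x (iter n nw_step x).
Proof.
elim: n => [|n IH]; first exact: reaches_refl.
by apply: reaches_trans IH _; exact: reaches_nw.
Qed.

(** The second coordinate minus the first grows by one at each step, so no site is revisited. *)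
Lemma iter_nw_inj x : injective (fun n => iter n nw_step x).
Proof.
have h n : (iter n nw_step x).2 - (iter n nw_step x).1 = x.2 - x.1 + n%:Z.
  elim: n => [|n IH] /=; first by rewrite addr0.
  move: (iter n nw_step x) IH => z IH.
  by rewrite /nw_step; case: ifP => _; rewrite !Z2E /=; lia.
by move=> m n /= mn; have := h m; rewrite mn h; lia.
Qed.

Lemma infinite_nw (A : set Z2) x :
  (forall n, A (iter n nw_step x)) -> infinite_set A.
Proof.
move=> h fA; apply: infinite_nat.
rewrite (_ : [set: nat] = (fun n => iter n nw_step x) @^-1` A).
  by apply: finite_preimage => // m n _ _; exact: iter_nw_inj.
by apply/seteqP; split=> // n _; exact: h.
Qed.

Lemma gigantic_sinks : has_gigantic_M w -> exists x, sinks w x.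
Proof.
move=> [x [_ fin]]; exists x; apply/sinksP => y.
have [[n [+ _]]|h] := pselect (exists n, Mset w x (iter n nw_step y)).
  exact/reaches_trans/reaches_iter_nw.
have nM n : (~` Mset w x) (iter n nw_step y) by move=> Mn; apply: h; exists n.
(* A path that avoids [Mset w x] forever puts infinitely many sites into one component of the
   complement. *)
exfalso; apply: (infinite_nw _ (fin y (nM 0%N))) => n.
exists (traject nw_step (nw_step y) n); split.
- elim: n y {h nM} => //= n IH y; rewrite IH andbT.
  by rewrite /nw_step; case: ifP => _; rewrite /Defs.adjacent addrAC subrr add0r.
- exact: last_traject.
- by move=> u; rewrite -trajectS => /trajectP[i _ ->]; exact: nM.
Qed.

Lemma infinite_sinks x : sinks w x -> infinite_set (sinks w).
Proof.
move=> sx; apply: (@infinite_nw _ x) => n.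
exact: sinks_reaches (reaches_iter_nw n x).
Qed.

Lemma sinks_gigantic x : sinks w x ->
  (forall y, ~ sinks w y -> finite_set (component (~` sinks w) y)) ->
  has_gigantic_M w.
Proof.
move=> sx fin; exists x; rewrite Mset_sink//; split; last exact: fin.
exact: infinite_sinks sx.
Qed.

End NorthWest.

(** * Paths without south steps *)

Lemma sinks_path w x p : sinks w x -> path (step w) x p ->
  forall u, u \in x :: p -> sinks w u.
Proof.
move=> sx; elim: p x sx => [|z p IH] x sx /=.
  by move=> _ u; rewrite inE => /eqP->.
move=> /andP[/stepP[e ew ->] xp] u; rewrite inE => /orP[/eqP->//|].
by apply: IH xp u; exact: sinks_step.
Qed.

Lemma finite_box (a b c d : int) :
  finite_set [set u : Z2 | a <= u.1 <= b /\ c <= u.2 <= d].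
Proof.
pose f (n : nat * nat) : Z2 := (a + n.1%:Z, c + n.2%:Z).
apply: (@sub_finite_set _ _
  (f @` (`I_(absz (b - a)).+1 `*` `I_(absz (d - c)).+1))).
  move=> [x y] /= [xab ycd]; exists (absz (x - a), absz (y - c)).
    by split=> /=; lia.
  by rewrite /f /=; congr (_, _); lia.
by apply: finite_image; apply: finite_setX; exact: finite_II.
Qed.

Definition no_south : rel Z2 :=
  fun u v => [|| v == u + e2, v == u + e1 | v == u - e1].

Section NoSouth.
Implicit Types (x u q : Z2) (p : seq Z2).

Lemma no_south_le x p q : path no_south x p -> q \in x :: p -> x.2 <= q.2.
Proof.
elim: p x => [|z p IH] x /=; first by move=> _; rewrite inE => /eqP->.
move=> /andP[xz zp]; rewrite inE => /orP[/eqP->//|/(IH _ zp)].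
by apply: le_trans; case/or3P: xz => /eqP->; rewrite !Z2E /=; lia.
Qed.

(** Discrete intermediate values: a step raises the row by at most one. *)
Lemma no_south_row x p r : path no_south x p -> x.2 <= r <= (last x p).2 ->
  exists2 q, q \in x :: p & q.2 = r.
Proof.
elim: p x => [|z p IH] x /=; first by move=> _ xr; exists x; [rewrite inE|lia].
move=> /andP[xz zp] xr.
have [xr0|xr0] := eqVneq x.2 r; first by exists x => //; rewrite inE eqxx.
have [|q qp qr] := IH _ zp.
  by case/or3P: xz xr => /eqP->; rewrite !Z2E /=; lia.
by exists q => //; rewrite inE qp orbT.
Qed.

(* A path without south steps visits two consecutive rows in one go, so it
   cannot pass from one side of a vertical edge between them to the other
   without meeting the edge. *)
Lemma no_south_side x p u : path no_south x p ->
  u \notin x :: p -> u + e2 \notin x :: p ->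
  forall q q', q \in x :: p -> q' \in x :: p ->
    u.2 <= q.2 <= u.2 + 1 -> u.2 <= q'.2 <= u.2 + 1 ->
    (q.1 < u.1) = (q'.1 < u.1).
Proof.
have off (z v : Z2) : z != v -> z.2 = v.2 -> z.1 <> v.1.
  by move=> /eqP zv h2 h1; apply: zv; exact: Z2_eq.
elim: p x => [|z p IH] x.
  by move=> _ _ _ q q'; rewrite !inE => /eqP-> /eqP->.
rewrite [path _ _ _]/= => /andP[xz zp] ux u'x.
have ux1 : u \notin z :: p by apply: contra ux => h; rewrite inE h orbT.
have u'x1 : u + e2 \notin z :: p by apply: contra u'x => h; rewrite inE h orbT.
(* Rows never decrease along the path, so [z] lies in the two rows as soon as [x] and the later
   vertex [q'] do. Only the step from [x] to [z] has to be examined. *)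
have key q' : q' \in z :: p -> u.2 <= x.2 <= u.2 + 1 ->
    u.2 <= q'.2 <= u.2 + 1 -> (x.1 < u.1) = (q'.1 < u.1).
  move=> q'z rx rq'.
  have zq' := no_south_le zp q'z.
  have xz2 : x.2 <= z.2 by case/or3P: xz => /eqP->; rewrite !Z2E /=; lia.
  rewrite -(IH _ zp ux1 u'x1 z q') ?inE ?eqxx//; last by lia.
  have := memPn ux x; rewrite inE eqxx => /(_ isT) /off xu.
  have := memPn u'x x; rewrite inE eqxx => /(_ isT) /off xu'.
  have := memPn ux z; rewrite !inE eqxx orbT => /(_ isT) /off zu.
  have := memPn u'x z; rewrite !inE eqxx orbT => /(_ isT) /off zu'.
  move: xu xu' zu zu'; rewrite !Z2E.
  by case/or3P: xz => /eqP E; rewrite E !Z2E /=; lia.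
move=> q q'; rewrite inE => /orP[/eqP->|qz]; rewrite inE => /orP[/eqP->|q'z] //.
- exact: key.
- by move=> rq rx; rewrite (key q).
- exact: IH zp ux1 u'x1 q q' qz q'z.
Qed.

(** The boolean lets one confinement lemma serve both the left and the right boundary. *)
Definition side (b : bool) (q u : Z2) : bool :=
  if b then q.1 < u.1 else u.1 < q.1.

(** A horizontal unit step cannot pass a path vertex without landing on it, and landing is excluded
    because path vertices are in [S]. A vertical step is an edge with both ends off the path, so
    [no_south_side] applies. *)
Lemma no_south_confine (S : set Z2) b x p u (e : stepE) :
  path no_south x p -> (forall q, q \in x :: p -> S q) -> ~ S (u + val e) ->
  x.2 <= u.2 <= (last x p).2 -> x.2 <= (u + val e).2 <= (last x p).2 ->
  (forall q, q \in x :: p -> q.2 = u.2 -> side b q u) ->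
  forall q, q \in x :: p -> q.2 = (u + val e).2 -> side b q (u + val e).
Proof.
move=> xp pS nS ru ru' su q qp q2.
have qu' : q.1 <> (u + val e).1.
  by move=> q1; apply: nS; rewrite -(Z2_eq q1 q2); exact: pS.
have up : u \notin x :: p.
  apply/negP => up; have := su u up erefl.
  by rewrite /side; case: b {su}; rewrite ltxx.
have u'p : u + val e \notin x :: p by apply/negP => /pS.
have [q0 q0p q02] := no_south_row xp ru.
have sq0 := su q0 q0p q02.
have horizontal : (val e).2 = 0 -> (val e).1 = 1 \/ (val e).1 = -1 ->
    side b q (u + val e).
  move=> e20 e11; move: (su q qp); rewrite q2 Z2E e20 addr0 => /(_ erefl).
  by move: qu'; rewrite /side !Z2E; case: e11 => ->; case: (b); lia.
(* [v] is the lower end of the vertical edge, in whichever direction it is crossed. *)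
have vertical (v : Z2) :
    (v = u /\ val e = e2) \/ (v = u + val e /\ v + e2 = u) ->
    side b q (u + val e).
  move=> hv.
  have vp : v \notin x :: p by case: hv => -[-> _].
  have v'p : v + e2 \notin x :: p.
    by case: hv => -[h1 h2]; [rewrite h1 -h2|rewrite h2].
  have := no_south_side xp vp v'p qp q0p.
  have [uv e1u] : u.1 = v.1 /\ (u + val e).1 = v.1.
    case: hv => -[h1 h2]; first by rewrite h2 h1 Z2E /=; lia.
    by rewrite -h1 -{1}h2 Z2E /=; lia.
  have rows : v.2 <= u.2 <= v.2 + 1 /\ v.2 <= (u + val e).2 <= v.2 + 1.
    case: hv => -[h1 h2]; first by rewrite h2 h1 Z2E /=; lia.
    by rewrite -h1 -{1 2}h2 Z2E /=; lia.
  rewrite q2 q02 => /(_ rows.2 rows.1) E.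
  move: E sq0 qu'; rewrite /side uv e1u.
  by case: (b); lia.
case: (stepE_cases e) => ee.
- by apply: horizontal; rewrite ee; [|left].
- by apply: (vertical u); left; rewrite ee.
- by apply: horizontal; rewrite ee; [|right].
- by apply: (vertical (u + val e)); right; rewrite ee /= subrK.
Qed.

End NoSouth.

(** The trap is the region enclosed by the two paths: sites in their row range with [p] on the left
    and [p'] on the right. *)
Lemma confined_between (S : set Z2) (x : Z2) p p' : path no_south x p ->
  path no_south x p' -> last x p' = last x p ->
  (forall q, q \in x :: p -> S q) -> (forall q, q \in x :: p' -> S q) ->
  forall y : Z2, x.2 <= y.2 <= (last x p).2 ->
    (forall q, q \in x :: p -> q.2 = y.2 -> q.1 < y.1) ->
    (forall q, q \in x :: p' -> q.2 = y.2 -> y.1 < q.1) ->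
  finite_set (component (~` S) y).
Proof.
move=> xp xp' lpp' pS p'S y ry py p'y.
pose A := [set u : Z2 | [/\ x.2 <= u.2 <= (last x p).2,
  forall q, q \in x :: p -> q.2 = u.2 -> side true q u &
  forall q, q \in x :: p' -> q.2 = u.2 -> side false q u]].
apply: (@component_finite S A) => //.
- pose M := \max_(q <- (x :: p) ++ (x :: p')) `|q.1|%N.
  have bM q : q \in (x :: p) ++ (x :: p') -> - M%:Z <= q.1 <= M%:Z.
    move=> qp; have := @leq_bigmax_seq _ _ xpredT (fun q : Z2 => `|q.1|%N) q qp isT.
    by rewrite -/M; case: (q) => [q1 q2] /=; move: M => M'; lia.
  apply: sub_finite_set (finite_box (- M%:Z) M%:Z x.2 (last x p).2).
  move=> u [ru lu ru'] /=; split=> //.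
  have [q qp q2] := no_south_row xp ru.
  have := lu q qp q2; have := bM q; rewrite mem_cat qp => /(_ isT).
  rewrite -lpp' in ru.
  have [q' q'p q'2] := no_south_row xp' ru.
  have := ru' q' q'p q'2; have := bM q'; rewrite mem_cat q'p orbT => /(_ isT).
  rewrite /side /=; lia.
- move=> u e [ru lu ru'] nS.
  have rue : x.2 <= (u + val e).2 <= (last x p).2.
    (* In the bottom and top rows the paths share an endpoint, which cannot be both left and right
       of [u]. Hence [u] is in neither row, and a vertical step stays in the row range. *)
    have ux : u.2 != x.2.
      apply/eqP => ux; have := lu x; have := ru' x.
      rewrite !inE eqxx ux /side => /(_ isT erefl) h1 /(_ isT erefl) h2.
      by have := lt_trans h1 h2; rewrite ltxx.
    have ul : u.2 != (last x p).2.
      apply/eqP => ul; have := lu (last x p); have := ru' (last x p).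
      rewrite mem_last -lpp' mem_last lpp' ul /side.
      move=> /(_ isT erefl) h1 /(_ isT erefl) h2.
      by have := lt_trans h1 h2; rewrite ltxx.
    by case: (stepE_cases e) => ->; rewrite Z2E /=; lia.
  split; first exact: rue.
    apply: (@no_south_confine S true x p u e) => //.
  by apply: (@no_south_confine S false x p' u e) => //; rewrite lpp'.
Qed.

(** * North-east and north-west corridors, for (H2) *)

Section Corridors.
Variable w : environment.

Definition corridor (h : stepE) : rel Z2 :=
  fun u v => (pe2 \in w u) && (v == u + e2) || (h \in w u) && (v == u + val h).

Definition creaches h x y := exists2 p, path (corridor h) x p & last x p = y.

Lemma corridor_step h u v : corridor h u v -> step w u v.
Proof.
by case/orP=> /andP[hu /eqP ->]; apply/stepP; [exists pe2|exists h].
Qed.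

Lemma creaches_refl h x : creaches h x x.
Proof. by exists [::]. Qed.

Lemma creaches_trans h x y z :
  creaches h x y -> creaches h y z -> creaches h x z.
Proof.
move=> [p xp <-] [q yq <-]; exists (p ++ q); last by rewrite last_cat.
by rewrite cat_path xp yq.
Qed.

Lemma creaches_up h x : pe2 \in w x -> creaches h x (x + e2).
Proof. by move=> N; exists [:: x + e2] => //=; rewrite /corridor N eqxx. Qed.

Lemma creaches_side h x : h \in w x -> creaches h x (x + val h).
Proof.
by move=> N; exists [:: x + val h] => //=; rewrite /corridor N eqxx orbT.
Qed.

Section Climb.
Variable h : stepE.
Hypothesis up_or_h : forall x, pe2 \in w x \/ h \in w x.
Hypothesis up_often :
  forall x : Z2, exists m : nat, pe2 \in w (x + val h *+ m.+1).

(** Where north is closed [h] is open, so the row can be followed up to the first site with a north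
    step. The induction is on the distance to the site given by [up_often]. *)
Lemma corridor_row x : exists m : nat,
  (forall i : nat, (i <= m)%N -> creaches h x (x + val h *+ i)) /\
  pe2 \in w (x + val h *+ m).
Proof.
have [m] := up_often x.
elim: m.+1 x => {m} [|m IH] x hm.
  exists 0%N; split=> // i; rewrite leqn0 => /eqP ->; rewrite addr0.
  exact: creaches_refl.
have [N|nN] := boolP (pe2 \in w x).
  exists 0%N; split; last by rewrite addr0.
  by move=> i; rewrite leqn0 => /eqP ->; rewrite addr0; exact: creaches_refl.
have [Nx|hx] := up_or_h x; first by rewrite Nx in nN.
rewrite mulrS addrA in hm.
have [k [kr kN]] := IH _ hm.
exists k.+1; split; last by rewrite mulrS addrA.
move=> [|i] ik; first by rewrite addr0; exact: creaches_refl.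
rewrite mulrS addrA; apply: creaches_trans (kr i ik).
exact: creaches_side.
Qed.

Lemma corridor_climb (x : Z2) (n : nat) : (val h).2 = 0 ->
  exists2 y, creaches h x y & y.2 = x.2 + n%:Z.
Proof.
move=> h2; elim: n => [|n [y xy y2]].
  by exists x; [exact: creaches_refl|rewrite addr0].
have [m [ym Nm]] := corridor_row y.
exists (y + val h *+ m + e2).
  apply: creaches_trans xy _; apply: creaches_trans (ym m (leqnn m)) _.
  exact: creaches_up.
rewrite !Z2E y2 h2 mul0rn /=; lia.
Qed.

End Climb.

Lemma corridor_le1 (x : Z2) p (q : Z2) :
  path (corridor pe1) x p -> q \in x :: p -> x.1 <= q.1.
Proof.
elim: p x => [|z p IH] x /=; first by move=> _; rewrite inE => /eqP->.
move=> /andP[xz zp]; rewrite inE => /orP[/eqP->//|/(IH _ zp)].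
by apply: le_trans; case/orP: xz => /andP[_ /eqP->]; rewrite !Z2E /=; lia.
Qed.

Lemma corridor_ge1 (x : Z2) p (q : Z2) :
  path (corridor ne1) x p -> q \in x :: p -> q.1 <= x.1.
Proof.
elim: p x => [|z p IH] x /=; first by move=> _; rewrite inE => /eqP->.
move=> /andP[xz zp]; rewrite inE => /orP[/eqP->//|/(IH _ zp)] h.
by apply: le_trans h _; case/orP: xz => /andP[_ /eqP->]; rewrite !Z2E /=; lia.
Qed.

Lemma no_south_corridor x p h : h = pe1 \/ h = ne1 -> path (corridor h) x p ->
  path no_south x p.
Proof.
move=> hh; apply: sub_path => u v; rewrite /no_south.
by case/orP=> /andP[_ /eqP->]; [rewrite eqxx|case: hh => -> /=; rewrite eqxx ?orbT].
Qed.

Hypothesis north_east : forall x, pe2 \in w x \/ pe1 \in w x.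
Hypothesis north_west : forall x, pe2 \in w x \/ ne1 \in w x.
Hypothesis north_often_east :
  forall x : Z2, exists m : nat, pe2 \in w (x + e1 *+ m.+1).
Hypothesis north_often_west :
  forall x : Z2, exists m : nat, pe2 \in w (x + (- e1) *+ m.+1).
Hypothesis west_often_north :
  forall x : Z2, exists m : nat, ne1 \in w (x + e2 *+ m.+1).

(** If [a] allows west, it moves west and the gap shrinks. Otherwise [a] goes north, while [b] runs
    east to its first north step and then climbs, unless it hits [a] before. Either the gap shrinks
    or [a] comes closer to a site above it that allows west. *)
Lemma corridors_meet (a b : Z2) : a.2 = b.2 -> b.1 <= a.1 ->
  exists c, creaches pe1 b c /\ creaches ne1 a c.
Proof.
move=> ab2 ab1.
have [d dab] : exists d : nat, a.1 - b.1 = d by exists `|a.1 - b.1|%N; lia.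
have [m hm] := west_often_north a.
(* Lexicographic induction on the gap [d] and then on the height [m] above [a] of a site that allows
   west. *)
elim/ltn_ind: d (m.+1) a b ab2 hm dab {ab1} => d IHd {}m.
have [->|d0] := eqVneq d 0%N.
  move=> a b ab2 _ dab; exists a; split; last exact: creaches_refl.
  have -> : a = b by apply: Z2_eq => //; lia.
  exact: creaches_refl.
have west (a b : Z2) : a.2 = b.2 -> a.1 - b.1 = d -> ne1 \in w a ->
    exists c, creaches pe1 b c /\ creaches ne1 a c.
  move=> ab2 dab Wa; have [k hk] := west_often_north (a - e1).
  have h1 : (d.-1 < d)%N by lia.
  have h2 : (a - e1).2 = b.2 by rewrite !Z2E /= ab2; lia.
  have h3 : (a - e1).1 - b.1 = d.-1 by rewrite !Z2E /=; lia.
  have [c [bc ac]] := IHd _ h1 _ _ _ h2 hk h3.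
  exists c; split=> //; apply: creaches_trans ac.
  exact: (@creaches_side ne1).
elim: m => [|m IHm] a b ab2 hm dab; first by apply: west => //; rewrite addr0 in hm.
have [Wa|nWa] := boolP (ne1 \in w a); first exact: west.
have [Na|Wa] := north_west a; last by rewrite Wa in nWa.
have [k [bk Nk]] := corridor_row north_east north_often_east b.
have [dk|kd] := leqP d k.
  exists a; split; last exact: creaches_refl.
  have := bk d dk; congr (creaches _ _ _).
  by apply: Z2_eq; rewrite !Z2E /= ?mul0rn; lia.
pose b' := b + e1 *+ k + e2.
have bb' : creaches pe1 b b'.
  apply: creaches_trans (bk k (leqnn k)) _; exact: creaches_up.
have aa' : creaches ne1 a (a + e2) by exact: creaches_up.
rewrite mulrS addrA in hm.
suff [c [b'c a'c]] : exists c, creaches pe1 b' c /\ creaches ne1 (a + e2) c.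
  by exists c; split; [exact: creaches_trans b'c|exact: creaches_trans a'c].
have ab'2 : (a + e2).2 = b'.2 by rewrite /b' !Z2E /= mul0rn; lia.
have dab' : (a + e2).1 - b'.1 = (d - k)%N by rewrite /b' !Z2E /=; lia.
have [k0|k0] := eqVneq k 0%N.
  by apply: IHm => //; rewrite dab' k0 subn0.
by apply: IHd hm dab' => //; lia.
Qed.

Lemma finite_complement_component (y : Z2) :
  (exists m : nat, sinks w (y + (- e2) *+ m.+1)) -> ~ sinks w y ->
  finite_set (component (~` sinks w) y).
Proof.
move=> [m sx] nsy; move xE : (y + _ : Z2) sx => x sx.
(* The site [y] is [m.+1] rows above [x]; climbing [m.+2] rows puts the continuations of both
   corridors strictly above the row of [y]. *)
have [b [p xp pb] b2] := corridor_climb north_west north_often_west x m.+2 erefl.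
have [a [q xq qa] a2] := corridor_climb north_east north_often_east x m.+2 erefl.
have bx : b.1 <= x.1 by rewrite -pb; apply: corridor_ge1 xp _; exact: mem_last.
have xa : x.1 <= a.1 by rewrite -qa; apply: corridor_le1 xq _; exact: mem_last.
have [|c [[r br rc] [s as_ sc]]] := @corridors_meet a b _ (le_trans bx xa).
  by rewrite a2 b2.
have nsW p' z := @no_south_corridor z p' ne1 (or_intror erefl).
have nsE p' z := @no_south_corridor z p' pe1 (or_introl erefl).
have sub_sinks (l : seq Z2) h h' (l' : seq Z2) : path (corridor h) x l ->
    path (corridor h') (last x l) l' ->
    forall u, u \in x :: l ++ l' -> sinks w u.
  move=> xl xl'; apply: sinks_path sx _; rewrite cat_path.
  apply/andP; split; [move: xl|move: xl']; apply: sub_path;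
    exact: corridor_step.
have pr_path : path (corridor pe1) (last x p) r by rewrite pb.
have qs_path : path (corridor ne1) (last x q) s by rewrite qa.
have [y1 y2] : y.1 = x.1 /\ y.2 = x.2 + m.+1%:Z.
  by rewrite -xE !Z2E /= mul0rn; lia.
have rc2 : c.2 >= b.2.
  by rewrite -rc; apply: no_south_le (nsE _ _ br) _; exact: mem_last.
have pS := sub_sinks _ _ _ _ xp pr_path.
have qS := sub_sinks _ _ _ _ xq qs_path.
apply: (@confined_between (sinks w) x (p ++ r) (q ++ s)) => //.
- by rewrite cat_path (nsW _ _ xp) (nsE _ _ pr_path).
- by rewrite cat_path (nsE _ _ xq) (nsW _ _ qs_path).
- by rewrite !last_cat pb qa rc sc.
- by rewrite last_cat pb rc; lia.
(* Only the part up to [b] meets the row of [y]. It lies weakly west of the common column of [x] and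
   [y], and strictly so in this row, since its vertices are sinks and [y] is not. *)
- move=> u up uy.
  have nuy : u.1 != y.1.
    by apply/eqP => u1; apply: nsy; rewrite -(Z2_eq u1 uy); exact: pS.
  move: up; rewrite -cat_cons mem_cat => /orP[/(corridor_ge1 xp) h|ur].
    by rewrite lt_neqAle nuy y1.
  have := no_south_le (nsE _ _ br) (q := u); rewrite inE ur orbT => /(_ isT).
  by rewrite uy y2 b2; lia.
- move=> u up uy.
  have nuy : u.1 != y.1.
    by apply/eqP => u1; apply: nsy; rewrite -(Z2_eq u1 uy); exact: qS.
  move: up; rewrite -cat_cons mem_cat => /orP[/(corridor_le1 xq) h|us].
    by rewrite lt_neqAle eq_sym nuy y1.
  have := no_south_le (nsW _ _ as_) (q := u); rewrite inE us orbT => /(_ isT).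
  by rewrite uy y2 a2; lia.
Qed.

End Corridors.

(** * Merging walks *)

(* The increments of a bounded harmonic function of the difference walk grow
   geometrically with ratio alpha / beta >= 1, so boundedness kills them. *)
Lemma bounded_harmonic_eq0 (R : realType) (v : nat -> R) (alpha beta : R) :
  0 < alpha -> 0 <= beta <= alpha -> v 0%N = 0 ->
  (forall d, 0 <= v d <= 1) ->
  (forall d, alpha * (v d.+1 - v d) = beta * (v d.+2 - v d.+1)) ->
  forall d, v d = 0.
Proof.
move=> a0 /andP[b0 ba] v0 v01 hv.
suff dv d : v d.+1 = v d by elim=> // d IH; rewrite dv.
have [be0|bn0] := eqVneq beta 0.
  move/eqP: (hv d); rewrite be0 mul0r mulf_eq0 gt_eqF//= subr_eq0.
  by move/eqP.
have bp : 0 < beta by rewrite lt_neqAle eq_sym bn0.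
have v1 : 0 <= v 1%N by case/andP: (v01 1%N).
have incr e : v 1%N <= v e.+1 - v e.
  elim: e => [|e IH]; first by rewrite v0 subr0.
  rewrite -(ler_pM2l bp) -hv; apply: ler_pM => //; exact: ltW.
have lin e : v 1%N *+ e <= v e.
  elim: e => [|e IH]; first by rewrite v0.
  by rewrite mulrSr; have := incr e; lra.
have v10 : v 1%N = 0.
  apply/eqP; rewrite eq_le v1 andbT leNgt; apply/negP => vp.
  have := lin (Num.bound (v 1%N)^-1); have /andP[_] := v01 (Num.bound (v 1%N)^-1).
  have : (v 1%N)^-1 < (Num.bound (v 1%N)^-1)%:R.
    by apply: archi_boundP; rewrite invr_ge0.
  rewrite -(ltr_pM2l vp) mulfV ?gt_eqF// mulr_natr; lra.
have : v d.+1 - v d = 0.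
  elim: d => [|d IH]; first by rewrite v10 v0 subr0.
  apply: (mulfI bn0); rewrite -hv IH !mulr0 //.
by move/eqP; rewrite subr_eq0 => /eqP.
Qed.

Definition diag : Z2 := (1, 1).

(* A pair of walks started at [s.1] and [s.1 + s.2 diag]: the lower one uses
   [up] whenever it can, the upper one [dn].  As [up = dn + diag], both stay on
   the same antidiagonal; the second component counts how far apart they are. *)
Definition merge_next (dn : stepE) (s : Z2 * nat) (b : bool * bool) :
    Z2 * nat :=
  (s.1 + val dn + diag *+ b.1, (s.2 + ~~ b.2 - b.1)%N).

(** One step of the pair sees the environment only through these two bits, each read at the site of
    its own walker. *)
Definition look (dn up : stepE) (w : environment) (s : Z2 * nat) :
    bool * bool :=
  (up \in w s.1, dn \in w (s.1 + diag *+ s.2)).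

Definition merge_step dn up w s := merge_next dn s (look dn up w s).

Definition apart dn up s : set environment :=
  [set w | forall n, (iter n (merge_step dn up w) s).2 != 0%N].

(** A time coordinate: constant along [diag] and, with the sign [eps] matched to [dn], increasing by
    one at every step of the pair. *)
Definition level (eps : int) (z : Z2) : int := eps * (z.1 - z.2).

Lemma diag1 : diag.1 = 1. Proof. by []. Qed.
Lemma diag2 : diag.2 = 1. Proof. by []. Qed.

Section Merge.
Variables (dn up : stepE) (eps : int).
Hypothesis eps_dn : eps * ((val dn).1 - (val dn).2) = 1.

Local Notation merge := (merge_step dn up).
Local Notation look := (look dn up).
Local Notation next := (merge_next dn).
Local Notation apart := (apart dn up).

Local Notation level := (level eps).

Lemma level_diag (z : Z2) n : level (z + diag *+ n) = level z.
Proof.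
rewrite /level; congr (_ * _).
by rewrite !Z2E diag1 diag2 opprD addrACA subrr addr0.
Qed.

Lemma level_next s b : level (next s b).1 = level s.1 + 1.
Proof. by rewrite level_diag /level !Z2E -eps_dn; ring. Qed.

Lemma measurable_look s b : measurable [set w : environment | look w s = b].
Proof.
rewrite (_ : [set _ | _] =
    [set w : environment | [set A : {set stepE} | (up \in A) = b.1] (w s.1)] `&`
    [set w : environment |
      [set A : {set stepE} | (dn \in A) = b.2] (w (s.1 + diag *+ s.2))]).
  by apply: measurableI; exact: measurable_coord.
by apply/seteqP; split=> w /=; [move=> <-|case: b => ? ? [/= <- <-]].
Qed.

(** Splitting over the four values of the first two bits makes the next state deterministic. *)
Lemma measurable_iter_merge n s (P : Z2 * nat -> bool) :
  measurable [set w : environment | P (iter n (merge w) s)].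
Proof.
elim: n s => [|n IH] s.
  by case: (boolP (P s)) => Ps; [rewrite (_ : [set _ | _] = setT)//|
    rewrite (_ : [set _ | _] = set0)//]; apply/seteqP; split=> w //=;
    rewrite ?(negbTE Ps).
rewrite (_ : [set _ | _] = \bigcup_(b : bool * bool)
   ([set w : environment | look w s = b] `&`
    [set w : environment | P (iter n (merge w) (next s b))])).
  apply: countable_bigcupT_measurable => // b.
  by apply: measurableI => //; exact: measurable_look.
apply/seteqP; split=> w /=.
  by rewrite -iterS iterSr => h; exists (look w s).
by move=> [b _ [<- h]]; rewrite -iterS iterSr.
Qed.

Lemma measurable_apart s : measurable (apart s).
Proof.
rewrite (_ : apart s =
    \bigcap_n [set w : environment | (iter n (merge w) s).2 != 0%N]).
  apply: bigcapT_measurable => n.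
  exact: (measurable_iter_merge n s (fun t => t.2 != 0%N)).
by apply/seteqP; split=> w h n; [move=> _|]; exact: h.
Qed.

Lemma apart_step w s : apart s w <-> s.2 <> 0%N /\ apart (merge w s) w.
Proof.
split=> [h|[/eqP s0 h] [|n] //].
  split; first by apply/eqP; exact: (h 0%N).
  by move=> n; rewrite -iterSr; exact: h.
by rewrite iterSr; exact: h.
Qed.

(** Both walkers sit on the level of [s] and gain one level per step, so lower levels are never
    read. *)
Lemma apart_depends s : depends_on [set z | level s.1 <= level z] (apart s).
Proof.
move=> w w' ww' h n.
suff <- : iter n (merge w) s = iter n (merge w') s by exact: h.
elim: n s {h} ww' => // n IH s ww'; rewrite !iterSr.
have <- : merge w s = merge w' s.
  by rewrite /merge_step /look !ww' ?inE /= ?level_diag.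
apply: IH => z; rewrite inE; rewrite [X in X _]/mkset level_next => zs.
by apply: ww'; rewrite inE /=; apply: le_trans zs; rewrite lerDl.
Qed.

Lemma apart_translate v w x d :
  apart (x, d) (translate v w) <-> apart (x + v, d) w.
Proof.
suff E n : iter n (merge w) (x + v, d) =
    ((iter n (merge (translate v w)) (x, d)).1 + v,
     (iter n (merge (translate v w)) (x, d)).2).
  by split=> h n; have := h n; rewrite E.
elim: n => // n IH; rewrite !iterS IH.
move: (iter n _ _) => [y k]; rewrite /merge_step /look /merge_next /translate /=.
rewrite [y + diag *+ k + v]addrAC; congr (_, _).
by rewrite [RHS]addrAC [y + val dn + v]addrAC.
Qed.

End Merge.

Lemma pr_split_bool d (T : measurableType d) (R : realType)
    (P : probability T R) (E : set T) (f : T -> bool) :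
  measurable E -> measurable [set t | f t = true] ->
  pr P E = pr P ([set t | f t = true] `&` E) +
           pr P ([set t | f t = false] `&` E).
Proof.
move=> mE mf; rewrite (pr_split P mE mf); congr (pr P _ + pr P _).
  by rewrite setIC.
by apply/seteqP; split=> t /=; [move=> [Et /negP/negbTE]|move=> [-> Et]].
Qed.

(** * Almost sure merging of the two walks *)

Section MergeProbability.
Context (R : realType) (mu : probability {set stepE} R)
  (nu : probability environment R).
Hypothesis hnu : is_product_measure mu nu.
Variables (dn up : stepE) (eps : int).
Hypothesis eps_dn : eps * ((val dn).1 - (val dn).2) = 1.

Let a : R := pr mu [set A : {set stepE} | up \in A].
Let c : R := pr mu [set A : {set stepE} | dn \in A].

Hypothesis a0 : 0 < a.
Hypothesis c0 : 0 < c.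
Hypothesis dn_or_up :
  mu [set A : {set stepE} | A :&: [set dn; up]%SET != finset.set0] = 1%E.

Let pr_bool (e : stepE) (b : bool) :
  pr mu [set A : {set stepE} | (e \in A) = b] =
  if b then pr mu [set A : {set stepE} | e \in A]
  else 1 - pr mu [set A : {set stepE} | e \in A].
Proof.
case: b => //; rewrite -pr_setC//; congr (pr _ _).
by apply/seteqP; split=> A /=; [move=> ->|move=> /negP/negbTE].
Qed.

Let a1 : a <= 1. Proof. exact: pr_le1. Qed.
Let c1 : c <= 1. Proof. exact: pr_le1. Qed.

Let ac1 : 1 <= a + c.
Proof.
rewrite -[1]/(fine (1%:E)) -dn_or_up -/(pr mu _).
apply: le_trans (pr_setU_le _ _ _) => //; apply: pr_le => //.
move=> A /set0Pn[e]; rewrite !inE => /andP[eA /orP[/eqP E|/eqP E]];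
  by [right; rewrite /= -E | left; rewrite /= -E].
Qed.

Let pL (b : bool) : R := if b then a else 1 - a.
Let pU (b : bool) : R := if b then c else 1 - c.

(** At positive distance the bits are read at two different sites, so they are independent even if
    [up] and [dn] are correlated at a single site. *)
Lemma pr_look (s : Z2 * nat) b : s.2 != 0%N ->
  pr nu [set w : environment | look dn up w s = b] = pL b.1 * pU b.2.
Proof.
move=> s0; set z := s.1 + diag *+ s.2.
have zs : z != s.1.
  apply/eqP => E; have : (z.1 : int) = s.1.1 by rewrite E.
  by rewrite /z fst_add fst_muln diag1 natz; lia.
rewrite (_ : [set _ | _] = cylinder [:: s.1; z]
  (fun x => if x == z then [set A : {set stepE} | (dn \in A) = b.2]
            else [set A : {set stepE} | (up \in A) = b.1])).
  apply: EFin_inj; rewrite -prE; last exact: measurable_cylinder.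
  rewrite (cylinderE hnu) /=; last by rewrite inE eq_sym zs.
  rewrite !big_cons big_nil mule1 eqxx eq_sym (negbTE zs).
  by rewrite /pL /pU -(pr_bool up) -(pr_bool dn) EFinM -!prE.
apply/seteqP; split=> w /=.
  move=> <- x; rewrite !inE => /orP[/eqP->|/eqP->]; last by rewrite eqxx.
  by rewrite eq_sym (negbTE zs).
move=> h; have := h s.1; rewrite !inE eqxx eq_sym (negbTE zs) => /(_ isT) /= hL.
have := h z; rewrite !inE eqxx orbT => /(_ isT) /= hU.
by case: b hL hU {h} => b1 b2 /= <- <-.
Qed.

(** Markov property: the bits are read on the current level, the future only on later levels. *)
Lemma pr_apart_look s b : s.2 != 0%N ->
  pr nu ([set w : environment | look dn up w s = b] `&`
    apart dn up (merge_next dn s b)) =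
  pL b.1 * pU b.2 * pr nu (apart dn up (merge_next dn s b)).
Proof.
move=> s0; rewrite -(pr_look b s0).
apply: (independent hnu (s := [:: s.1; s.1 + diag *+ s.2])).
- exact: measurable_look.
- exact: measurable_apart.
- move=> w w' ww' <-; rewrite /look !ww' // inE /= !inE eqxx ?orbT //.
- move=> w w' ww'; apply: (apart_depends eps_dn (s := merge_next dn s b)) => z.
  move=> /set_mem zs; apply/ww'/mem_set.
  have := level_next eps_dn s b; move: zs; rewrite /mkset => zs E.
  rewrite /= !inE => /orP[] /eqP zE; move: zs;
    by rewrite E zE ?level_diag gerDl ler10.
Qed.

Lemma pr_apart s x : pr nu (apart dn up s) = pr nu (apart dn up (x, s.2)).
Proof.
rewrite -[RHS](pr_translate hnu (s.1 - x)); last exact: measurable_apart.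
congr (pr nu _); apply/seteqP; case: s => y d; split=> w /=.
  by move=> h; apply/apart_translate; rewrite addrC subrK.
by move=> /apart_translate; rewrite addrC subrK.
Qed.

Let v d : R := pr nu (apart dn up (0, d)).

(** Conditioning on the two bits: the distance drops by one, stays in two cases, or grows by one. *)
Lemma pr_apart_rec d :
  v d.+1 = pL true * pU true * v d + pL true * pU false * v d.+1 +
           (pL false * pU true * v d.+1 + pL false * pU false * v d.+2).
Proof.
pose s : Z2 * nat := (0, d.+1).
pose z : Z2 := s.1 + diag *+ s.2.
have mE := measurable_apart dn up s.
have mf (e : stepE) x : measurable [set w : environment | (e \in w x) = true].
  exact: (measurable_coord x [set A : {set stepE} | (e \in A) = true]).
have mfF (e : stepE) x : measurable [set w : environment | (e \in w x) = false].
  exact: (measurable_coord x [set A : {set stepE} | (e \in A) = false]).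
have look_apart b1 b2 :
    [set w : environment | (dn \in w z) = b2] `&`
      ([set w : environment | (up \in w s.1) = b1] `&` apart dn up s) =
    [set w : environment | look dn up w s = (b1, b2)] `&`
      apart dn up (merge_next dn s (b1, b2)).
  apply/seteqP; split=> w /=.
    move=> [<- [<- /apart_step[_ h]]]; split=> //.
  by move=> [[<- <-] h]; split=> //; split=> //; apply/apart_step.
have term b1 b2 : pr nu ([set w : environment | (dn \in w z) = b2] `&`
      ([set w : environment | (up \in w s.1) = b1] `&` apart dn up s)) =
    pL b1 * pU b2 * v (d.+1 + ~~ b2 - b1)%N.
  by rewrite look_apart pr_apart_look// (pr_apart _ 0).
rewrite {1}/v (pr_split_bool nu mE (mf up s.1)).
rewrite (pr_split_bool nu (measurableI _ _ (mf up s.1) mE) (mf dn z)).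
rewrite (pr_split_bool nu (measurableI _ _ (mfF up s.1) mE) (mf dn z)).
by rewrite !term /= !addn0 !subn0 addn1 subn1 /= subSS subn0.
Qed.

Lemma merge_eventually :
  {ae nu, forall (w : environment) s,
    exists n, (iter n (merge_step dn up w) s).2 = 0%N}.
Proof.
have v0 d : v d = 0.
  (* These are the probabilities that the distance shrinks and that it grows; the first is at least
     the second exactly because [1 <= a + c]. *)
  apply: (@bounded_harmonic_eq0 R v (a * c) ((1 - a) * (1 - c))).
  - exact: mulr_gt0.
  - have := ac1; have := a1; have := c1 => c1' a1' ac1'.
    by apply/andP; split; nra.
  - rewrite /v (_ : apart _ _ _ = set0) ?pr_set0//.
    by apply/seteqP; split=> // w /(_ 0%N).
  - by move=> e; rewrite pr_ge0 ?pr_le1//; exact: measurable_apart.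
  - by move=> e; have := pr_apart_rec e; rewrite /pL /pU; lra.
apply: ae_forall_countable => s; exists (apart dn up s); split.
- exact: measurable_apart.
- apply: etrans (prE nu (measurable_apart _ _ _)) _.
  by rewrite (pr_apart _ 0) -/(v _) v0.
- move=> w /= h n; apply/eqP => n0; apply: h; by exists n.
Qed.

End MergeProbability.

(** * Confinement between merging walks *)

Definition rails (S : set Z2) (s : Z2 * nat) := S s.1 /\ S (s.1 + diag *+ s.2).

Definition between (s : Z2 * nat) (u : Z2) :=
  exists2 j : nat, (0 < j < s.2)%N & u = s.1 + diag *+ j.

Lemma finite_between s : finite_set (between s).
Proof.
apply: (@sub_finite_set _ _ ((fun j : nat => s.1 + diag *+ j) @` `I_s.2)).
  by move=> _ [j /andP[_ js] ->]; exists j.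
by apply: finite_image; exact: finite_II.
Qed.

Section Rails.
Variables (w : environment) (dn up : stepE).
Hypothesis up_dn : val up = val dn + diag.
Hypothesis dn_or_up : forall x, dn \in w x \/ up \in w x.

Local Notation merge := (merge_step dn up w).

(** A walk gives up its preferred step only when that is closed, and then [dn_or_up] opens the other
    one. Both walks thus follow open steps and remain among the sinks. *)
Lemma rails_merge s :
  s.2 != 0%N -> rails (sinks w) s -> rails (sinks w) (merge s).
Proof.
case: s => x d; rewrite /rails /merge_step /look /merge_next /= => d0 [Sx Sd].
split.
  case: (boolP (up \in w x)) => [xu|nxu].
    by rewrite mulr1n -addrA -up_dn; exact: sinks_step.
  rewrite mulr0n addr0; case: (dn_or_up x) => [|h]; last by rewrite h in nxu.
  exact: sinks_step.
set z := x + diag *+ d in Sd *.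
(* As [d] is nonzero, the truncated subtraction is exact, and the upper walker moves from [z] by
   [dn] or, failing that, by [up]. *)
have -> : x + val dn + diag *+ (up \in w x) +
    diag *+ (d + (dn \notin w z) - (up \in w x)) =
    z + val dn + diag *+ (dn \notin w z).
  rewrite -[LHS]addrA -mulrnDr subnKC; last by case: (up \in w x) => /=; lia.
  by rewrite mulrnDr addrA /z; congr (_ + _); rewrite addrAC.
case: (boolP (dn \in w z)) => [zd|nzd].
  by rewrite mulr0n addr0; exact: sinks_step.
rewrite mulr1n -addrA -up_dn; case: (dn_or_up z) => [h|]; first by rewrite h in nzd.
exact: sinks_step.
Qed.

(** From inside the gap a step leads at worst to an end of the next gap. The ends are in [S], so a
    target outside [S] is strictly inside. *)
Lemma between_forward (S : set Z2) s u (e : stepE) : e = dn \/ e = up ->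
  rails S (merge s) -> between s u -> ~ S (u + val e) ->
  between (merge s) (u + val e).
Proof.
move=> hE [S1 S2] [j js ->] nS.
have [t tE] : exists t : bool, val e = val dn + diag *+ t.
  by case: hE => ->; [exists false; rewrite addr0|exists true; rewrite up_dn].
pose l : bool := up \in w s.1.
have E : s.1 + diag *+ j + val e = (merge s).1 + diag *+ (j + t - l).
  rewrite /merge_step /merge_next /look /= -/l -[RHS]addrA -mulrnDr subnKC.
    by rewrite tE mulrnDr addrA [s.1 + _ + _]addrAC addrA [s.1 + _ + _]addrAC.
  by case: (l); lia.
exists (j + t - l)%N => //; apply/andP; split.
  rewrite lt0n; apply/eqP => z; apply: nS; rewrite E z addr0 //.
rewrite ltn_neqAle; apply/andP; split.
  by apply/eqP => z; apply: nS; rewrite E z.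
rewrite /merge_step /merge_next /look /= -/l.
by move: (~~ _) (l) (t) => [] [] []; lia.
Qed.

(** Undoing a step leads at worst to an end of the previous gap, and these ends are in [S]. *)
Lemma between_backward (S : set Z2) s u (e : stepE) : e = dn \/ e = up ->
  rails S s -> between (merge s) u -> ~ S (u - val e) -> between s (u - val e).
Proof.
move=> hE [S1 S2] [j js ->] nS.
have [t tE] : exists t : bool, val e = val dn + diag *+ t.
  by case: hE => ->; [exists false; rewrite addr0|exists true; rewrite up_dn].
pose l : bool := up \in w s.1.
have E : (merge s).1 + diag *+ j - val e = s.1 + diag *+ (l + j - t).
  rewrite /merge_step /merge_next /look /= -/l tE.
  have h : diag *+ l + diag *+ j = diag *+ (l + j - t) + diag *+ t.
    rewrite -!mulrnDr subnK//.
    by case: (t) (l) => [] []; lia.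
  by apply/eqP; rewrite subr_eq -addrA h addrACA.
exists (l + j - t)%N => //; apply/andP; split.
  by rewrite lt0n; apply/eqP => z; apply: nS; rewrite E z addr0.
rewrite ltn_neqAle; apply/andP; split.
  by apply/eqP => z; apply: nS; rewrite E z.
move: js; rewrite /merge_step /merge_next /look /= -/l.
by move: (~~ _) (l) (t) => [] [] []; lia.
Qed.

Definition run (s : Z2 * nat) (n : nat) :=
  [set u | exists2 i : nat, (i < n)%N & between (iter i merge s) u].

Lemma finite_run s n : finite_set (run s n).
Proof.
rewrite (_ : run s n = \bigcup_(i in `I_n) between (iter i merge s)).
  apply: bigcup_finite; first exact: finite_II.
  by move=> i _; exact: finite_between.
by apply/seteqP; split=> u [i ? ?]; exists i.
Qed.

Definition merges_at (s : Z2 * nat) (n : nat) :=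
  (iter n merge s).2 = 0%N /\ forall i, (i < n)%N -> (iter i merge s).2 != 0%N.

Lemma ex_merges_at s :
  (exists n, (iter n merge s).2 = 0%N) -> exists n, merges_at s n.
Proof.
move=> h; have {}h : exists n, (iter n merge s).2 == 0%N.
  by have [n /eqP hn] := h; exists n.
case: (ex_minnP h) => n /eqP hn hmin; exists n; split=> // i.
by apply: contraTneq => /eqP /hmin; rewrite leqNgt.
Qed.

Lemma rails_iter s n i : merges_at s n -> rails (sinks w) s -> (i <= n)%N ->
  rails (sinks w) (iter i merge s).
Proof.
move=> [_ hn] Ss; elim: i => // i IH lin.
by rewrite iterS; apply: rails_merge; [exact: hn|apply/IH/ltnW].
Qed.

Lemma run_forward s n i u (e : stepE) : e = dn \/ e = up ->
  merges_at s n -> rails (sinks w) s -> (i < n)%N ->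
  between (iter i merge s) u -> ~ sinks w (u + val e) -> run s n (u + val e).
Proof.
move=> he hn Ss lin hu nS.
have := @between_forward _ _ _ _ he (rails_iter hn Ss lin) hu nS.
rewrite -iterS => hu'; exists i.+1 => //.
(* At the meeting time [n] the gap is empty, so the step cannot lead there. *)
rewrite ltn_neqAle lin andbT; apply/eqP => in'.
by case: hu' => j; rewrite in' hn.1 ltn0 andbF.
Qed.

Lemma run_backward s n i u (e : stepE) : e = dn \/ e = up ->
  merges_at s n -> rails (sinks w) s -> (i.+1 < n)%N ->
  between (iter i.+1 merge s) u -> ~ sinks w (u - val e) -> run s n (u - val e).
Proof.
move=> he hn Ss lin hu nS; exists i; first exact: ltnW.
apply: between_backward hu nS => //.
by apply: rails_iter hn Ss _; apply/ltnW/ltnW.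
Qed.

End Rails.

(** The trap is the union of the gaps of both pairs up to their meeting times. The pairs share the
    initial gap and use opposite steps, so a backward step out of that gap is a forward step of the
    other pair; all other steps stay in the same run. *)
Lemma finite_component_rails (w : environment) (dn up dn' up' : stepE)
    (s : Z2 * nat) (n n' : nat) (y : Z2) :
  val up = val dn + diag -> val dn' = - val up -> val up' = - val dn ->
  (forall e : stepE, (e = dn \/ e = up) \/ (e = dn' \/ e = up')) ->
  (forall x : Z2, dn \in w x \/ up \in w x) ->
  (forall x : Z2, dn' \in w x \/ up' \in w x) ->
  merges_at w dn up s n -> merges_at w dn' up' s n' ->
  rails (sinks w) s -> between s y ->
  finite_set (component (~` sinks w) y).
Proof.
move=> up_dn dn'E up'E all_e h h' hn hn' Ss sy.
have up'_dn' : val up' = val dn' + diag.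
  by rewrite up'E dn'E up_dn opprD subrK.
have s0 : s.2 != 0%N by case: sy => j; lia.
have pos dn1 up1 n1 : merges_at w dn1 up1 s n1 -> (0 < n1)%N.
  by case: n1 => // -[/= s00 _]; rewrite s00 in s0.
have [n0 n'0] := (pos _ _ _ hn, pos _ _ _ hn').
apply: (@component_finite _ (run w dn up s n `|` run w dn' up' s n')).
- by rewrite finite_setU; split; exact: finite_run.
- by left; exists 0%N.
- move=> u e [[[|i] lin hu]|[[|i] lin hu]] nS; case: (all_e e) => he.
  + by left; apply: run_forward hu nS.
  + by right; apply: (@run_forward w dn' up' up'_dn' h' s n' 0%N).
  + by left; apply: run_forward hu nS.
  + left; have [e' he' eE] : exists2 e', e' = dn \/ e' = up & val e = - val e'.
      by case: he => ->; [exists up; [right|]|exists dn; [left|]].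
    by rewrite eE in nS *; apply: run_backward hu nS.
  + by left; apply: (@run_forward w dn up up_dn h s n 0%N).
  + by right; apply: run_forward hu nS.
  + right; have [e' he' eE] : exists2 e', e' = dn' \/ e' = up' & val e = - val e'.
      by case: he => ->; [exists up'|exists dn'];
        rewrite ?up'E ?dn'E ?opprK//; [right|left].
    by rewrite eE in nS *; apply: run_backward hu nS.
  + by right; apply: run_forward hu nS.
Qed.

(** * Almost sure properties of the environment *)

Section AlmostSure.
Context (R : realType) (mu : probability {set stepE} R)
  (nu : probability environment R).
Hypothesis hnu : is_product_measure mu nu.

Lemma pr_coord x (B : set {set stepE}) :
  pr nu [set w : environment | B (w x)] = pr mu B.
Proof.
rewrite (_ : [set _ | _] = cylinder [:: x] (fun=> B)).
  by rewrite /pr (cylinderE hnu)// big_seq1.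
apply/seteqP; split=> w /=; first by move=> Bw y; rewrite inE => /eqP ->.
by apply; rewrite inE.
Qed.

Lemma ae_coord (e e' : stepE) :
  mu [set A : {set stepE} | A :&: [set e; e']%SET != finset.set0] = 1%E ->
  {ae nu, forall (w : environment) x, e \in w x \/ e' \in w x}.
Proof.
move=> mu1; apply: ae_forall_countable => x.
pose B := [set A : {set stepE} | A :&: [set e; e']%SET != finset.set0].
have mB := measurable_coord x B.
exists (~` [set w : environment | B (w x)]); split; first exact: measurableC.
  apply: etrans (prE nu (measurableC mB)) _.
  by rewrite pr_setC// pr_coord /pr mu1 subrr.
apply: subsetC => w /set0Pn[f]; rewrite !inE => /andP[fw /orP[/eqP E|/eqP E]];
  by [left; rewrite -E | right; rewrite -E].
Qed.

Lemma ae_recurrent_step (e : stepE) (v : Z2) : v != 0 ->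
  (0 < mu [set A : {set stepE} | e \in A])%E ->
  {ae nu, forall (w : environment) (x : Z2),
    exists m : nat, e \in w (x + v *+ m.+1)}.
Proof.
move=> v0 mue.
pose A := [set w : environment | [set A : {set stepE} | e \in A] (w 0)].
have : {ae nu, forall w y, exists m : nat, A (translate (y + v *+ m.+1) w)}.
  apply: (recurrence hnu v0); first exact: measurable_coord.
  by rewrite pr_coord -lte_fin -prE.
apply: filterS => w h x; have [m] := h x.
by rewrite /A /translate /= add0r; exists m.
Qed.

Lemma ae_recurrent_sinks (v : Z2) : v != 0 ->
  0 < pr nu [set w : environment | sinks w 0] ->
  {ae nu, forall (w : environment) (x : Z2),
    exists m : nat, sinks w (x + v *+ m.+1)}.
Proof.
move=> v0 hs.
have := recurrence hnu v0 (measurable_sinks 0) hs.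
apply: filterS => w h x; have [m /sinks_translate] := h x.
by rewrite add0r; exists m.
Qed.

(** If the origin were almost surely not a sink, translation invariance and countability would
    exclude sinks everywhere, against [gigantic_sinks]. *)
Lemma ae_gigantic_pr_sinks :
  {ae nu, forall w : environment, has_gigantic_M w} ->
  {ae nu, forall (w : environment) x, pe2 \in w x \/ ne1 \in w x} ->
  0 < pr nu [set w : environment | sinks w 0].
Proof.
move=> hg hnw; rewrite lt_neqAle eq_sym pr_ge0 ?andbT; last exact: measurable_sinks.
apply/negP => /eqP s0.
have hns : {ae nu, forall (w : environment) x, ~ sinks w x}.
  apply: ae_forall_countable => x; exists [set w : environment | sinks w x].
  have ms := measurable_sinks x; split=> //.
    apply: etrans (prE nu ms) _; apply: (congr1 EFin).
    rewrite -[RHS]s0 -(pr_translate hnu x (measurable_sinks 0)).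
    congr (pr _ _); apply/seteqP; split=> w /=.
      by move=> h; apply/sinks_translate; rewrite add0r.
    by move=> /sinks_translate; rewrite add0r.
  by move=> w /= /contrapT.
have [A [mA A0 hA]] : {ae nu, forall w : environment, False}.
  apply: filterS (filterI hg (filterI hnw hns)) => w [g [nw ns]].
  by have [x /ns] := gigantic_sinks nw g.
have AT : A = setT by apply/seteqP; split=> // w _; apply: hA.
have : pr nu setT = 0 by rewrite /pr -AT A0.
by move/eqP; rewrite pr_setT oner_eq0.
Qed.

End AlmostSure.

(** * The equivalence, with enclosure by sinks under (H1) and under (H2) *)

Theorem theorem4p8 (R : realType) (mu : probability {set stepE} R)
    (nu : probability environment R) (hnu : is_product_measure mu nu)
    (hmu : hypH1 mu \/ hypH2 mu) :
  {ae nu, forall w : environment, has_gigantic_M w} <->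
  (0 < nu [set w : environment | Bset w (0 : Z2)%R = [set: Z2]])%E.
Proof.
(* The north-or-west condition is common to both sets of hypotheses. *)
have hnw : {ae nu, forall (w : environment) x, pe2 \in w x \/ ne1 \in w x}.
  by apply: (ae_coord hnu); case: hmu => [[_ []]|[[]]].
rewrite (prE nu (measurable_sinks 0)) lte_fin.
split=> [hg|hs]; first exact: (ae_gigantic_pr_sinks hnu hg hnw).
have e0 (e : stepE) : val e != 0 by case: (stepE_cases e) => ->.
have diag0 : diag != 0 by [].
have gigantic : {ae nu, forall (w : environment) (y : Z2), ~ sinks w y ->
    finite_set (component (~` sinks w) y)} ->
    {ae nu, forall w : environment, has_gigantic_M w}.
  move=> hfin.
  (* Recurrence serves here to produce one sink almost surely; any nonzero direction would do. *)
  have := ae_recurrent_sinks hnu diag0 hs.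
  move=> hrec; apply: filterS (filterI hnw (filterI hfin hrec)) => w [nw [fin rec]].
  have [m sx] := rec 0; exact: sinks_gigantic nw _ sx fin.
apply: gigantic; case: hmu => [[mupos [hL hR]]|[[hNE hNW] mupos]].
- have prpos (e : stepE) : 0 < pr mu [set A : {set stepE} | e \in A].
    by rewrite -lte_fin -prE.
  have hL' :
      mu [set A : {set stepE} | A :&: [set ne1; pe2]%SET != finset.set0] = 1%E.
    rewrite -hL; congr (mu _); apply/seteqP.
    by split=> A /=; rewrite finset.setUC.
  (* North-west steps lower the first coordinate minus the second and south-east steps raise it,
     hence the signs [-1] and [1]. *)
  have mL := @merge_eventually R mu nu hnu ne1 pe2 (-1) erefl
    (prpos _) (prpos _) hL'.
  have mR := @merge_eventually R mu nu hnu ne2 pe1 1 erefl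
    (prpos _) (prpos _) hR.
  have aR := ae_coord hnu hR.
  have sU := ae_recurrent_sinks hnu diag0 hs.
  have sD : {ae nu, forall (w : environment) (x : Z2),
      exists m : nat, sinks w (x + (- diag) *+ m.+1)}.
    by apply: (ae_recurrent_sinks hnu _ hs); rewrite oppr_eq0.
  apply: filterS (filterI hnw (filterI aR (filterI mL (filterI mR (filterI sU sD))))).
  move=> w [nw [se [mgL [mgR [su sd]]]]] y nsy.
  have [m sx] := sd y; have [m' sz] := su y.
  (* The walks start from the sinks below and above [y] on its diagonal, so [y] has index [m.+1] in
     the initial gap. *)
  pose s : Z2 * nat := (y + (- diag) *+ m.+1, (m.+1 + m'.+1)%N).
  have [n hn] := ex_merges_at (mgL s).
  have [n' hn'] := ex_merges_at (mgR s).
  apply: (finite_component_rails _ _ _ _ _ _ hn hn') => //.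
  + by move=> e; case: (stepE_cases e) => ->; tauto.
  + by move=> x; case: (nw x); tauto.
  + by split=> //=; rewrite mulrnDr addrA mulNrn subrK.
  + by exists m.+1; rewrite /= ?mulNrn ?subrK//; lia.
- have aNE := ae_coord hnu hNE.
  have nE := ae_recurrent_step hnu (e0 pe1) (mupos pe2 isT).
  have nW := ae_recurrent_step hnu (e0 ne1) (mupos pe2 isT).
  have wN := ae_recurrent_step hnu (e0 pe2) (mupos ne1 isT).
  have sS := ae_recurrent_sinks hnu (e0 ne2) hs.
  apply: filterS (filterI hnw (filterI aNE (filterI nE (filterI nW (filterI wN sS))))).
  move=> w [nw [ne [h1 [h2 [h3 h4]]]]] y nsy.
  exact: finite_complement_component ne nw h1 h2 h3 y (h4 y) nsy.
Qed.
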